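(* Let $F : \mathsf{CohI}^n \to \mathsf{CohI}$ be a fixed $\mathrm{MALL}_2$-definable finite normal functor. The function $\vec{X} \mapsto F(\vec{X})$ is computable in logarithmic space. For any clique $c \subseteq \mathrm{Tr}(F)$, the function $\vec{X} \mapsto c_{\vec{X}} \subseteq F(\vec{X})$ is computable in logarithmic space.
   Context: $\mathsf{CohI}$: coherence spaces $X=(|X|,\frown\!\!\!\!\smile_X)$ (reflexive symmetric relation) with embeddings. $F$ is the interpretation, in Girard's coherence space model, of a $\mathrm{MALL}_2$ formula (connectives $1,\bot,\otimes,⅋,0,\top,\oplus,\&,\forall,\exists$, no exponentials); finite means preserving finite cardinality and with finite degree (sup of web sizes of its normal forms). $\mathrm{Tr}(F)$ is the trace (coherence space of self-coherent normal forms $(\vec Y\vdash y)$), and the clique $c$ corresponds to the uniform family $c_{\vec X}=\{F(\iota_1,\ldots,\iota_n)(y)\mid(\vec Y\vdash y)\in c,\ \iota_i:Y_i\hookrightarrow X_i\}$. Inputs $\vec X$ are finite coherence spaces. *)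

(* Defs.v *)
From mathcomp Require Export all_boot.
From mathcomp Require Export boolp classical_sets cardinality.

Set Implicit Arguments.
Unset Strict Implicit.
Unset Printing Implicit Defensive.

Local Open Scope classical_set_scope.

Record category := Category {
  ob :> Type;
  hom : ob -> ob -> Type;
  idm : forall X, hom X X;
  cmp : forall X Y Z, hom Y Z -> hom X Y -> hom X Z;
  cmp1f : forall X Y (f : hom X Y), cmp (idm Y) f = f;
  cmpf1 : forall X Y (f : hom X Y), cmp f (idm X) = f;
  cmpA : forall X Y Z T (h : hom Z T) (g : hom Y Z) (f : hom X Y),
    cmp h (cmp g f) = cmp (cmp h g) f }.
Arguments hom {c}.
Arguments idm {c}.
Arguments cmp {c X Y Z}.

Record functor (C D : category) := Functor {
  fobj :> C -> D;
  farr : forall X Y : C, hom X Y -> hom (fobj X) (fobj Y);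
  farr1 : forall X, farr (idm X) = idm (fobj X);
  farrM : forall X Y Z (g : hom Y Z) (f : hom X Y),
    farr (cmp g f) = cmp (farr g) (farr f) }.
Arguments farr {C D} F {X Y} f : rename.

Definition is_iso (C : category) (X Y : C) (f : hom X Y) : Prop :=
  exists g : hom Y X, cmp g f = idm X /\ cmp f g = idm Y.

Definition is_pullback (C : category) (A B D P : C)
    (f : hom A D) (g : hom B D) (p : hom P A) (q : hom P B) : Prop :=
  cmp f p = cmp g q /\
  forall (T : C) (u : hom T A) (v : hom T B), cmp f u = cmp g v ->
    exists! h : hom T P, cmp p h = u /\ cmp q h = v.

Definition is_filtered (J : category) : Prop :=
  [/\ exists j : J, True,
      forall i j : J, exists (k : J) (_ : hom i k) (_ : hom j k), True
    & forall (i j : J) (u v : hom i j),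
        exists (k : J) (w : hom j k), cmp w u = cmp w v].

Definition is_cocone (J C : category) (D : functor J C) (L : C)
    (c : forall j, hom (D j) L) : Prop :=
  forall (i j : J) (u : hom i j), cmp (c j) (farr D u) = c i.

Definition is_colimit (J C : category) (D : functor J C) (L : C)
    (c : forall j, hom (D j) L) : Prop :=
  is_cocone c /\
  forall (M : C) (d : forall j, hom (D j) M), is_cocone d ->
    exists! h : hom L M, forall j, cmp h (c j) = d j.

Section CompFunctor.
Variables (C D E : category) (G : functor D E) (F : functor C D).

Lemma comp_functor1 X : farr G (farr F (idm X)) = idm (G (F X)).
Proof. by rewrite !farr1. Qed.

Lemma comp_functorM X Y Z (g : hom Y Z) (f : hom X Y) :
  farr G (farr F (cmp g f)) = cmp (farr G (farr F g)) (farr G (farr F f)).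
Proof. by rewrite !farrM. Qed.

Definition comp_functor : functor C E :=
  @Functor C E (fun X => G (F X)) (fun X Y f => farr G (farr F f))
    comp_functor1 comp_functorM.
End CompFunctor.

Definition preserves_pullbacks (C D : category) (F : functor C D) : Prop :=
  forall (X1 X2 X3 X0 : C)
    (f : hom X1 X3) (g : hom X2 X3) (p : hom X0 X1) (q : hom X0 X2),
  is_pullback f g p q ->
  is_pullback (farr F f) (farr F g) (farr F p) (farr F q).

Definition preserves_filtered_colimits (C D : category) (F : functor C D) :
    Prop :=
  forall J : category, is_filtered J ->
  forall (G : functor J C) (L : C) (c : forall j, hom (G j) L),
  is_colimit c ->
  is_colimit (D := comp_functor F G) (fun j => farr F (c j)).

Section Power.
Variables (C : category) (n : nat).

Let phom (X Y : 'I_n -> C) := forall i, hom (X i) (Y i).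

Definition power : category.
Proof.
apply: (@Category ('I_n -> C) phom (fun X i => idm (X i))
  (fun X Y Z g f i => cmp (g i) (f i))).
- by move=> X Y f; apply: functional_extensionality_dep => i; apply: cmp1f.
- by move=> X Y f; apply: functional_extensionality_dep => i; apply: cmpf1.
- by move=> X Y Z T h g f; apply: functional_extensionality_dep => i;
    apply: cmpA.
Defined.
End Power.

Record coh := Coh {
  web :> Type;
  cohr : web -> web -> Prop;
  cohr_refl : forall x, cohr x x;
  cohr_sym : forall x y, cohr x y -> cohr y x }.
Arguments cohr {c}.

Record emb (X Y : coh) := Emb {
  emb_fun :> X -> Y;
  emb_inj : injective emb_fun;
  emb_coh : forall x y, cohr (emb_fun x) (emb_fun y) <-> cohr x y }.

Lemma emb_eq (X Y : coh) (f g : emb X Y) : f =1 g -> f = g.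
Proof.
case: f g => [f fi fc] [g gi gc] /= /funext E; move: fi fc gi gc; rewrite E.
by move=> fi fc gi gc; rewrite (Prop_irrelevance fi gi) (Prop_irrelevance fc gc).
Qed.

Definition emb_id (X : coh) : emb X X :=
  @Emb X X id (@inj_id X) (fun x y => iff_refl _).

Definition emb_comp (X Y Z : coh) (g : emb Y Z) (f : emb X Y) : emb X Z :=
  @Emb X Z (g \o f) (inj_comp (@emb_inj _ _ g) (@emb_inj _ _ f))
    (fun x y => iff_trans (emb_coh g (f x) (f y)) (emb_coh f x y)).

Definition CohI : category.
Proof.
apply: (@Category coh emb emb_id emb_comp).
- by move=> *; apply: emb_eq.
- by move=> *; apply: emb_eq.
- by move=> *; apply: emb_eq.
Defined.

Notation "'CohI^' n" := (power CohI n) (at level 2, n at level 1).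

Definition clique (X : coh) (a : set X) : Prop :=
  forall x y, a x -> a y -> cohr x y.

Record normal_functor (n : nat) := NormalFunctor {
  nfun :> functor CohI^n CohI;
  nfun_pullback : preserves_pullbacks nfun;
  nfun_filtered : preserves_filtered_colimits nfun }.

Lemma emb_ext (X Y : coh) (f g : emb X Y) : f = g -> f =1 g.
Proof. by move=> ->. Qed.

Definition pullback_on_web (A B D P : coh)
    (f : emb A D) (g : emb B D) (p : emb P A) (q : emb P B) : Prop :=
  (forall x, f (p x) = g (q x)) /\
  forall a b, f a = g b -> exists x, p x = a /\ q x = b.

Definition point_coh (P : Prop) : coh :=
  @Coh P (fun _ _ => True) (fun _ => I) (fun _ _ _ => I).

Definition point_emb (P : Prop) (X : coh) (x : P -> X) : emb (point_coh P) X.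
Proof.
apply: (@Emb (point_coh P) X x); first by move=> a b _; exact: (@Prop_irrelevance P a b).
by move=> a b; rewrite (@Prop_irrelevance P a b : a = b); split=> // _; apply: cohr_refl.
Defined.

Section Lift.
Variables (A B D P T : coh) (f : emb A D) (g : emb B D) (p : emb P A)
  (q : emb P B) (u : emb T A) (v : emb T B).
Hypothesis pb : pullback_on_web f g p q.
Hypothesis uv : forall t, f (u t) = g (v t).

Lemma pullback_lift :
  exists h : emb T P, emb_comp p h = u /\ emb_comp q h = v.
Proof.
have /choice [h hP] : forall t, exists x, p x = u t /\ q x = v t.
  by move=> t; apply: pb.2; apply: uv.
have hi : injective h.
  by move=> s t E; apply: (@emb_inj _ _ u); rewrite -(hP s).1 -(hP t).1 E.
have hc s t : cohr (h s) (h t) <-> cohr s t.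
  by rewrite -(emb_coh p) (hP s).1 (hP t).1; apply: emb_coh.
by exists (Emb hi hc); split; apply: emb_eq => t /=; [exact: (hP t).1|exact: (hP t).2].
Qed.
End Lift.

Lemma pullback_CohIP (A B D P : CohI)
    (f : hom A D) (g : hom B D) (p : hom P A) (q : hom P B) :
  is_pullback f g p q <-> pullback_on_web f g p q.
Proof.
split=> [[E U]|pb].
  split=> [x|a b Eab]; first exact: (emb_ext E x).
  have [|h [[h1 h2] _]] := U (point_coh True) (point_emb (fun=> a)) (point_emb (fun=> b)).
    by apply: emb_eq.
  exists ((h : emb _ _) I).
  by split; [exact: (emb_ext h1 I)|exact: (emb_ext h2 I)].
split=> [|T u v E]; first by apply: emb_eq => x; apply: pb.1.
have [h [h1 h2]] := pullback_lift pb (emb_ext E).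
exists h; split=> // h' [h1' _]; apply: emb_eq => t; apply: (@emb_inj _ _ p).
by have := emb_ext (etrans h1 (esym h1')) t.
Qed.

Lemma pullback_powerP (n : nat) (A B D P : CohI^n)
    (f : hom A D) (g : hom B D) (p : hom P A) (q : hom P B) :
  is_pullback f g p q <-> forall i, pullback_on_web (f i) (g i) (p i) (q i).
Proof.
have app (X Y : CohI^n) (h k : hom X Y) : h = k -> forall i, (h i : emb _ _) =1 k i.
  by move=> ->.
split=> [[E U] i|pb].
  split=> [x|a b Eab]; first exact: (app _ _ _ _ E i x).
  pose T : CohI^n := fun k => point_coh (k = i).
  pose cst (X : CohI^n) (x : X i : coh) : hom T X :=
    fun k => @point_emb (k = i) (X k) (fun e => eq_rect_r (fun k => X k : coh) x e).
  have [|h [[h1 h2] _]] := U T (cst A a) (cst B b).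
    apply: functional_extensionality_dep => k; apply: emb_eq => /= e.
    by case: _ / (esym e) (e) => e' /=; rewrite (Prop_irrelevance e' erefl).
  exists ((h i : emb _ _) erefl).
  by split; [exact: (app _ _ _ _ h1 i erefl)|exact: (app _ _ _ _ h2 i erefl)].
split=> [|T u v E].
  by apply: functional_extensionality_dep => i; apply: emb_eq => x; apply: (pb i).1.
have L i : {h : emb (T i) (P i) | emb_comp (p i) h = u i /\ emb_comp (q i) h = v i}.
  by apply: cid; apply: (pullback_lift (pb i)) => t; apply: (app _ _ _ _ E i t).
exists (fun i => sval (L i)); split.
  by split; apply: functional_extensionality_dep => i; case: (svalP (L i)).
move=> h' [h1' _]; apply: functional_extensionality_dep => i; apply: emb_eq => t.
apply: (@emb_inj _ _ (p i)); case: (svalP (L i)) => h1 _.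
by rewrite [LHS](emb_ext h1 t) -[RHS]/(emb_comp _ _ t) -(app _ _ _ _ h1' i t).
Qed.

Definition sub_coh (X : coh) (S : set X) : coh :=
  @Coh {x : X | S x} (fun x y => cohr (sval x) (sval y))
    (fun x => cohr_refl (sval x)) (fun x y => @cohr_sym X (sval x) (sval y)).

Lemma sval_inj (T : Type) (S : T -> Prop) : injective (@sval T S).
Proof. by move=> [x p] [y q] /= E; apply: eq_exist. Qed.

Definition sub_emb (X : coh) (S : set X) : emb (sub_coh S) X :=
  @Emb (sub_coh S) X sval (@sval_inj _ _) (fun x y => iff_refl _).

Definition corestr (X Y : coh) (S : set Y) (f : emb X Y) (fS : forall x, S (f x)) :
  emb X (sub_coh S).
Proof.
apply: (@Emb X (sub_coh S) (fun x => exist _ (f x) (fS x))).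
  by move=> x y /(congr1 sval); apply: emb_inj.
by move=> x y; apply: emb_coh.
Defined.

Definition jointly_surjective (J : Type) (D : J -> coh) (L : coh)
    (c : forall j, emb (D j) L) : Prop :=
  forall x : L, exists j y, c j y = x.

Lemma colimit_CohI_surj (J : category) (D : functor J CohI) (L : CohI)
    (c : forall j, hom (D j) L) :
  is_colimit c -> jointly_surjective c.
Proof.
move=> [cc U].
pose S : set (L : coh) := fun x => exists j y, (c j : emb _ _) y = x.
have cS j x : S ((c j : emb _ _) x) by exists j, x.
have [|h [hP _]] := U (sub_coh S) (fun j => corestr (cS j)).
  by move=> i j u; apply: emb_eq => x; apply: sval_inj; apply: (emb_ext (cc i j u) x).
have [k [_ kU]] := U L c cc.
have E1 : k = idm L by apply: kU => j; apply: cmp1f.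
have E2 : k = emb_comp (sub_emb S) h.
  apply: kU => j; apply: emb_eq => x.
  by have /(congr1 sval) := emb_ext (hP j) x.
by move=> x; have := emb_ext (etrans (esym E2) E1) x => /= <-; apply: (svalP ((h : emb _ _) x)).
Qed.

Lemma colimit_power_surj (n : nat) (J : category) (D : functor J CohI^n)
    (L : CohI^n) (c : forall j, hom (D j) L) :
  is_colimit c -> forall i, jointly_surjective (fun j => c j i).
Proof.
have app (X Y : CohI^n) (h k : hom X Y) : h = k -> forall i, (h i : emb _ _) =1 k i.
  by move=> ->.
move=> [cc U] i.
pose S k : set (L k : coh) := fun x => exists j y, (c j k : emb _ _) y = x.
have cS j k x : S k ((c j k : emb _ _) x) by exists j, x.
have [|h [hP _]] := U (fun k => sub_coh (S k)) (fun j k => corestr (cS j k)).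
  move=> a b u; apply: functional_extensionality_dep => k.
  by apply: emb_eq => x; apply: sval_inj; apply: (app _ _ _ _ (cc a b u) k x).
have [k [_ kU]] := U L c cc.
have E1 : k = idm L by apply: kU => j; apply: cmp1f.
have E2 : k = fun k => emb_comp (sub_emb (S k)) (h k).
  apply: kU => j; apply: functional_extensionality_dep => m; apply: emb_eq => x.
  by have /(congr1 sval) := app _ _ _ _ (hP j) m x.
move=> x; have := app _ _ _ _ (etrans (esym E2) E1) i x => /= <-.
exact: (svalP ((h i : emb _ _) x)).
Qed.

Section Glue.
Variables (J : category) (D : J -> coh).
Variable (D1 : forall i j : J, hom i j -> emb (D i) (D j)).
Variables (L M : coh) (c : forall j, emb (D j) L) (d : forall j, emb (D j) M).
Hypothesis fJ : is_filtered J.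
Hypothesis cc : forall i j u x, c j (D1 u x) = c i x :> L.
Hypothesis dd : forall i j u x, d j (D1 u x) = d i x :> M.
Hypothesis cs : jointly_surjective c.

Lemma colimit_glue : exists h : emb L M, forall j, emb_comp h (c j) = d j.
Proof.
have /choice [h hP] : forall x, exists z, exists j y, c j y = x /\ d j y = z.
  by move=> x; have [j [y e]] := cs x; exists (d j y), j, y.
have common x y : exists j a b,
    [/\ c j a = x, d j a = h x, c j b = y & d j b = h y].
  have [i [a [<- <-]]] := hP x; have [j [b [<- <-]]] := hP y.
  case: fJ => _ /(_ i j) [k [u [v _]]] _.
  by exists k, (D1 u a), (D1 v b); rewrite !cc !dd.
have hi : injective h.
  move=> x y; have [j [a [b [<- <- <- <-]]]] := common x y.
  by move=> /(@emb_inj _ _ (d j)) ->.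
have hc x y : cohr (h x) (h y) <-> cohr x y.
  have [j [a [b [<- <- <- <-]]]] := common x y.
  by rewrite !emb_coh.
exists (Emb hi hc) => j; apply: emb_eq => x /=.
have [i [a [e <-]]] := hP (c j x); case: fJ => _ /(_ i j) [k [u [v _]]] _.
rewrite -(dd u) -(dd v); congr (d k _); apply: (@emb_inj _ _ (c k)).
by rewrite !cc.
Qed.
End Glue.

Lemma surj_colimit_CohI (J : category) (D : functor J CohI) (L : CohI)
    (c : forall j, hom (D j) L) :
  is_filtered J -> is_cocone c -> jointly_surjective c -> is_colimit c.
Proof.
move=> fJ cc cs; split=> // M d dd.
have [h hP] := @colimit_glue J D (@farr _ _ D) L M c d fJ
  (fun i j u => emb_ext (cc i j u)) (fun i j u => emb_ext (dd i j u)) cs.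
exists h; split=> // h' hP'; apply: emb_eq => x; have [j [y <-]] := cs x.
by have := emb_ext (etrans (hP j) (esym (hP' j))) y.
Qed.

Lemma surj_colimit_power (n : nat) (J : category) (D : functor J CohI^n)
    (L : CohI^n) (c : forall j, hom (D j) L) :
  is_filtered J -> is_cocone c ->
  (forall i, jointly_surjective (fun j => c j i)) -> is_colimit c.
Proof.
have app (X Y : CohI^n) (h k : hom X Y) : h = k -> forall i, (h i : emb _ _) =1 k i.
  by move=> ->.
move=> fJ cc cs; split=> // M d dd.
have G i : {h : emb (L i) (M i) | forall j, emb_comp h (c j i) = d j i}.
  apply: cid.
  exact: (@colimit_glue J (fun j => D j i) (fun a b u => farr D u i) (L i) (M i)
    (fun j => c j i) (fun j => d j i) fJ
    (fun a b u => app _ _ _ _ (cc a b u) i)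
    (fun a b u => app _ _ _ _ (dd a b u) i) (cs i)).
exists (fun i => sval (G i)); split.
  by move=> j; apply: functional_extensionality_dep => i; apply: (svalP (G i)).
move=> h' hP'; apply: functional_extensionality_dep => i; apply: emb_eq => x.
have [j [y <-]] := cs i x.
by rewrite [LHS](emb_ext (svalP (G i) j) y) -(app _ _ _ _ (hP' j) i y).
Qed.

Section OnWebs.
Variables (n : nat) (F : functor CohI^n CohI).

Definition web_pullbacks : Prop :=
  forall (X1 X2 X3 X0 : CohI^n)
    (f : hom X1 X3) (g : hom X2 X3) (p : hom X0 X1) (q : hom X0 X2),
  (forall i, pullback_on_web (f i) (g i) (p i) (q i)) ->
  forall a b, (farr F f : emb _ _) a = (farr F g : emb _ _) b ->
  exists x, (farr F p : emb _ _) x = a /\ (farr F q : emb _ _) x = b.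

Definition web_filtered : Prop :=
  forall J : category, is_filtered J ->
  forall (G : functor J CohI^n) (L : CohI^n) (c : forall j, hom (G j) L),
  is_cocone c -> (forall i, jointly_surjective (fun j => c j i)) ->
  jointly_surjective (fun j => farr F (c j)).

Lemma web_pullbacksP : preserves_pullbacks F <-> web_pullbacks.
Proof.
split=> H X1 X2 X3 X0 f g p q.
  by move=> /pullback_powerP /H /pullback_CohIP [].
move=> pb; apply/pullback_CohIP; split; last by apply: H; apply/pullback_powerP.
by case: pb => E _; move: (congr1 (farr F) E); rewrite !farrM => /emb_ext.
Qed.

Lemma web_filteredP : preserves_filtered_colimits F <-> web_filtered.
Proof.
split=> H J fJ G L c.
  move=> cc cs; have /(H J fJ) : is_colimit c by apply: surj_colimit_power.
  exact: colimit_CohI_surj.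
move=> cl; have [cc _] := cl; apply: surj_colimit_CohI => //.
  by move=> i j u; rewrite -(cc i j u) farrM.
by apply: H => //; apply: colimit_power_surj.
Qed.
End OnWebs.

Record fincoh := FinCoh {
  fcard : nat;
  fadj : rel 'I_fcard;
  fadj_refl : reflexive fadj;
  fadj_sym : symmetric fadj }.

Definition coh_of_fin (X : fincoh) : coh.
Proof.
apply: (@Coh 'I_(fcard X) (fun x y => fadj x y)); first exact: fadj_refl.
by move=> x y; rewrite fadj_sym.
Defined.

Definition coh_of_fins n (X : 'I_n -> fincoh) : CohI^n :=
  fun i => coh_of_fin (X i).

Section Trace.
Variables (n : nat) (F : functor CohI^n CohI).

(* [(Y |- y)], with the finite space [Y] taken in a skeleton; normality says
   that [y] does not come from a proper subspace of [Y]. *)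
Record nform := NForm {
  nf_sp : 'I_n -> fincoh;
  nf_pt : web (F (coh_of_fins nf_sp));
  nf_min : forall (Z : CohI^n) (k : hom Z (coh_of_fins nf_sp)) (z : web (F Z)),
    (farr F k : emb _ _) z = nf_pt -> is_iso k }.

Definition nf_iso (a b : nform) : Prop :=
  exists t : hom (coh_of_fins (nf_sp a)) (coh_of_fins (nf_sp b)),
    is_iso t /\ (farr F t : emb _ _) (nf_pt a) = nf_pt b.

Definition nf_coh (a b : nform) : Prop :=
  forall (Z : CohI^n) (f : hom (coh_of_fins (nf_sp a)) Z)
    (g : hom (coh_of_fins (nf_sp b)) Z),
  cohr ((farr F f : emb _ _) (nf_pt a)) ((farr F g : emb _ _) (nf_pt b)).

Lemma nf_iso_refl a : nf_iso a a.
Proof.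
exists (idm _); split; last by rewrite farr1.
by exists (idm _); rewrite cmp1f.
Qed.

Lemma nf_iso_sym a b : nf_iso a b -> nf_iso b a.
Proof.
move=> [t [[s [st ts]] E]]; exists s; split; first by exists t.
rewrite -E; have := congr1 (farr F) st.
by rewrite farrM farr1 => /emb_ext /(_ (nf_pt a)).
Qed.

Lemma nf_iso_trans a b c : nf_iso a b -> nf_iso b c -> nf_iso a c.
Proof.
move=> [t [[t' [t1 t2]] E]] [s [[s' [s1 s2]] E']]; exists (cmp s t); split.
  exists (cmp t' s'); split.
    by rewrite cmpA -(cmpA t') s1 cmpf1 t1.
  by rewrite cmpA -(cmpA s) t2 cmpf1 s2.
by rewrite farrM /= E.
Qed.

Lemma nf_iso_class a b : nf_iso a b -> nf_iso a = nf_iso b.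
Proof.
move=> ab; apply/funext => c; apply/propext; split.
  by apply: nf_iso_trans; apply: nf_iso_sym.
exact: nf_iso_trans.
Qed.

Lemma nf_coh_sym a b : nf_coh a b -> nf_coh b a.
Proof. by move=> H Z f g; apply: cohr_sym. Qed.

Lemma nf_coh_isol a a' b : nf_iso a a' -> nf_coh a b -> nf_coh a' b.
Proof.
move=> [t [_ E]] H Z f g; rewrite -E.
by have := H Z (cmp f t) g; rewrite farrM.
Qed.

Lemma nf_coh_iso a a' b b' :
  nf_iso a a' -> nf_iso b b' -> nf_coh a b -> nf_coh a' b'.
Proof.
move=> ha hb H; apply: (nf_coh_isol ha); apply: nf_coh_sym.
by apply: (nf_coh_isol hb); apply: nf_coh_sym.
Qed.

(* Self-coherent normal forms up to isomorphism, as equivalence classes. *)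
Definition trace_web : Type :=
  {C : set nform | exists a, nf_coh a a /\ C = nf_iso a}.

Definition trace_coh (C D : trace_web) : Prop :=
  forall a b, sval C a -> sval D b -> nf_coh a b.

Lemma trace_coh_refl C : trace_coh C C.
Proof.
case: C => C [a [aa E]] b c /=; rewrite E => ab ac; exact: (nf_coh_iso ab ac).
Qed.

Lemma trace_coh_sym C D : trace_coh C D -> trace_coh D C.
Proof. by move=> H a b ha hb; apply: nf_coh_sym; apply: H. Qed.

Definition Tr : coh := Coh trace_coh_refl trace_coh_sym.

Definition nf_class (a : nform) (aa : nf_coh a a) : Tr :=
  exist _ (nf_iso a : set nform) (ex_intro _ a (conj aa erefl)).

Lemma nf_class_eq a b aa bb : nf_iso a b -> @nf_class a aa = @nf_class b bb.
Proof. by move=> ab; apply: sval_inj; apply: nf_iso_class. Qed.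

Lemma nf_class_inj a b aa bb : @nf_class a aa = @nf_class b bb -> nf_iso a b.
Proof. by move=> /(congr1 sval) /= ->; apply: nf_iso_refl. Qed.

Lemma nf_class_surj (C : Tr) : exists a aa, C = @nf_class a aa.
Proof.
by case: C => C [a [aa E]]; exists a, aa; apply: sval_inj.
Qed.

Lemma nf_class_coh a b aa bb :
  cohr (@nf_class a aa) (@nf_class b bb) <-> nf_coh a b.
Proof.
split=> [|H c d /= ac bd]; first by apply; apply: nf_iso_refl.
exact: (nf_coh_iso ac bd).
Qed.

Definition family (c : set Tr) (X : CohI^n) : set (web (F X)) :=
  [set x | exists C : Tr, c C /\ exists a : nform, sval C a /\
     exists i : hom (coh_of_fins (nf_sp a)) X,
       x = (farr F i : emb _ _) (nf_pt a)].

Definition preserves_finiteness : Prop :=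
  forall X : CohI^n, (forall i, finite_set [set: web (X i)]) ->
    finite_set [set: web (F X)].

(* The web size of a tuple of spaces is the total size of its components. *)
Definition finite_degree : Prop :=
  exists d : nat, forall a : nform, \sum_(i < n) fcard (nf_sp a i) <= d.

Definition finite_functor : Prop := preserves_finiteness /\ finite_degree.
End Trace.
Arguments family {n F} c X.

Lemma mk_normal n (F : functor CohI^n CohI) :
  web_pullbacks F -> web_filtered F -> normal_functor n.
Proof.
by move=> p f; exists F; [exact/web_pullbacksP|exact/web_filteredP].
Defined.

Section Var.
Variables (n : nat) (i : 'I_n).

Definition var_functor : functor CohI^n CohI :=
  @Functor CohI^n CohI (fun X => X i) (fun X Y f => f i)
    (fun X => erefl) (fun X Y Z g f => erefl).

Definition nvar : normal_functor n.
Proof.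
apply: (@mk_normal n var_functor).
  by move=> X1 X2 X3 X0 f g p q /(_ i) [].
by move=> J fJ G L c cc /(_ i).
Defined.
End Var.

Definition dual_coh (X : coh) : coh.
Proof.
apply: (@Coh (web X) (fun x y => x = y \/ ~ cohr x y)); first by left.
by move=> x y [->|h]; [left|right=> /cohr_sym].
Defined.

Definition dual_emb (X Y : coh) (f : emb X Y) : emb (dual_coh X) (dual_coh Y).
Proof.
apply: (@Emb (dual_coh X) (dual_coh Y) f); first exact: (@emb_inj _ _ f).
move=> x y /=; rewrite emb_coh; split=> [] [h|h]; try by right.
  by left; exact: (@emb_inj _ _ f _ _ h).
by left; rewrite h.
Defined.

Section Dual.
Variables (n : nat) (F : normal_functor n).

Definition dual_functor : functor CohI^n CohI.
Proof.
apply: (@Functor CohI^n CohI (fun X => dual_coh (F X))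
  (fun X Y f => dual_emb (farr F f))).
  by move=> X; apply: emb_eq => x /=; rewrite farr1.
by move=> X Y Z g f; apply: emb_eq => x /=; rewrite farrM.
Defined.

Definition ndual : normal_functor n.
Proof.
apply: (@mk_normal n dual_functor).
  by have /web_pullbacksP := @nfun_pullback _ F.
by have /web_filteredP := @nfun_filtered _ F.
Defined.
End Dual.

Definition unit_coh : coh :=
  @Coh unit (fun _ _ => True) (fun _ => I) (fun _ _ _ => I).

Definition empty_coh : coh :=
  @Coh void (fun _ _ => True) (fun _ => I) (fun _ _ _ => I).

Section Const.
Variables (n : nat) (X : coh).

Definition const_functor : functor CohI^n CohI.
Proof.
by apply: (@Functor CohI^n CohI (fun=> X) (fun _ _ _ => emb_id X)) => // *;
  apply: emb_eq.
Defined.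

Definition nconst : normal_functor n.
Proof.
apply: (@mk_normal n const_functor).
  by move=> X1 X2 X3 X0 f g p q pb a b /= ->; exists b.
by move=> J [[j _] _ _] G L c cc cs x; exists j, x.
Defined.
End Const.

Definition tensor_coh (X Y : coh) : coh.
Proof.
apply: (@Coh (X * Y)%type (fun x y => cohr x.1 y.1 /\ cohr x.2 y.2)).
  by move=> x; split; apply: cohr_refl.
by move=> x y [? ?]; split; apply: cohr_sym.
Defined.

Definition tensor_emb (X Y X' Y' : coh) (f : emb X X') (g : emb Y Y') :
  emb (tensor_coh X Y) (tensor_coh X' Y').
Proof.
apply: (@Emb (tensor_coh X Y) (tensor_coh X' Y') (fun x => (f x.1, g x.2))).
  by move=> [x y] [x' y'] /= [/emb_inj -> /emb_inj ->].
by move=> x y /=; rewrite !emb_coh.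
Defined.

Definition plus_coh (X Y : coh) : coh.
Proof.
apply: (@Coh (X + Y)%type (fun x y => match x, y with
  | inl a, inl b => cohr a b | inr a, inr b => cohr a b | _, _ => False end)).
  by case=> x; apply: cohr_refl.
by case=> x [] y //; apply: cohr_sym.
Defined.

Definition plus_emb (X Y X' Y' : coh) (f : emb X X') (g : emb Y Y') :
  emb (plus_coh X Y) (plus_coh X' Y').
Proof.
apply: (@Emb (plus_coh X Y) (plus_coh X' Y') (fun x => match x with
  | inl a => inl (f a) | inr b => inr (g b) end)).
  by case=> x [] y //= [] /emb_inj ->.
by case=> x [] y /=; rewrite ?emb_coh.
Defined.

Section Binary.
Variables (n : nat) (F G : normal_functor n).

Let Fp : web_pullbacks F. Proof. exact/web_pullbacksP/nfun_pullback. Qed.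
Let Gp : web_pullbacks G. Proof. exact/web_pullbacksP/nfun_pullback. Qed.
Let Ff : web_filtered F. Proof. exact/web_filteredP/nfun_filtered. Qed.
Let Gf : web_filtered G. Proof. exact/web_filteredP/nfun_filtered. Qed.

Definition tensor_functor : functor CohI^n CohI.
Proof.
apply: (@Functor CohI^n CohI (fun X => tensor_coh (F X) (G X))
  (fun X Y f => tensor_emb (farr F f) (farr G f))).
  by move=> X; apply: emb_eq => -[x y] /=; rewrite !farr1.
by move=> X Y Z g f; apply: emb_eq => -[x y] /=; rewrite !farrM.
Defined.

Definition ntensor : normal_functor n.
Proof.
apply: (@mk_normal n tensor_functor).
  move=> X1 X2 X3 X0 f g p q pb [a a'] [b b'] /= [e e'].
  have [x [<- <-]] := Fp pb e; have [y [<- <-]] := Gp pb e'.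
  by exists (x, y).
move=> J fJ D L c cc cs [x y].
have [i [a <-]] := Ff fJ cc cs x; have [j [b <-]] := Gf fJ cc cs y.
case: fJ => _ /(_ i j) [k [u [v _]]] _.
exists k, ((farr F (farr D u) : emb _ _) a, (farr G (farr D v) : emb _ _) b).
rewrite /= -(cc _ _ u) -(cc _ _ v) !farrM.
by [].
Defined.

Definition plus_functor : functor CohI^n CohI.
Proof.
apply: (@Functor CohI^n CohI (fun X => plus_coh (F X) (G X))
  (fun X Y f => plus_emb (farr F f) (farr G f))).
  by move=> X; apply: emb_eq => -[x|x] /=; rewrite !farr1.
by move=> X Y Z g f; apply: emb_eq => -[x|x] /=; rewrite !farrM.
Defined.

Definition nplus : normal_functor n.
Proof.
apply: (@mk_normal n plus_functor).
  move=> X1 X2 X3 X0 f g p q pb [a|a] [b|b] //= [e].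
    by have [x [<- <-]] := Fp pb e; exists (inl x).
  by have [x [<- <-]] := Gp pb e; exists (inr x).
move=> J fJ D L c cc cs [x|x].
  by have [i [a <-]] := Ff fJ cc cs x; exists i, (inl a).
by have [i [a <-]] := Gf fJ cc cs x; exists i, (inr a).
Defined.
End Binary.

Section Cat.
Variables (n k : nat).

Definition pcat (X : CohI^n) (Y : CohI^k) : CohI^(n + k) :=
  fun i => match split i with inl j => X j | inr j => Y j end.

Definition pcat_hom (X X' : CohI^n) (Y Y' : CohI^k) (f : hom X X')
    (g : hom Y Y') : hom (pcat X Y) (pcat X' Y') :=
  fun i => match split i as s return
      emb (match s with inl j => X j | inr j => Y j end)
          (match s with inl j => X' j | inr j => Y' j end)
    with inl j => f j | inr j => g j end.

Lemma pcat_hom1 X Y : pcat_hom (idm X) (idm Y) = idm (pcat X Y).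
Proof.
apply: functional_extensionality_dep => i.
by rewrite /pcat_hom /= /pcat; case: split.
Qed.

Lemma pcat_homM (X1 X2 X3 : CohI^n) (Y1 Y2 Y3 : CohI^k)
    (f : hom X2 X3) (f' : hom X1 X2) (g : hom Y2 Y3) (g' : hom Y1 Y2) :
  pcat_hom (cmp f f') (cmp g g') = cmp (pcat_hom f g) (pcat_hom f' g').
Proof.
apply: functional_extensionality_dep => i.
by rewrite /= /pcat_hom /pcat; case: split.
Qed.

Lemma pcat_pullback (X1 X2 X3 X0 : CohI^n) (Y1 Y2 Y3 Y0 : CohI^k)
    (f : hom X1 X3) (g : hom X2 X3) (p : hom X0 X1) (q : hom X0 X2)
    (f' : hom Y1 Y3) (g' : hom Y2 Y3) (p' : hom Y0 Y1) (q' : hom Y0 Y2) :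
  (forall i, pullback_on_web (f i) (g i) (p i) (q i)) ->
  (forall i, pullback_on_web (f' i) (g' i) (p' i) (q' i)) ->
  forall i, pullback_on_web (pcat_hom f f' i) (pcat_hom g g' i)
    (pcat_hom p p' i) (pcat_hom q q' i).
Proof. by move=> H H' i; rewrite /pcat_hom /pcat; case: split. Qed.
End Cat.

Section Partial.
Variables (n k : nat) (F : functor CohI^(n + k) CohI) (X : CohI^n).

Definition papp : functor CohI^k CohI.
Proof.
apply: (@Functor CohI^k CohI (fun Y => F (pcat X Y))
  (fun Y Y' g => farr F (pcat_hom (idm X) g))).
  by move=> Y; rewrite pcat_hom1 farr1.
by move=> Y Y' Y'' g f; rewrite -farrM -pcat_homM cmp1f.
Defined.
End Partial.

Section Forall.
Variables (n k : nat) (F : normal_functor (n + k)).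

Let Fp : web_pullbacks F. Proof. exact/web_pullbacksP/nfun_pullback. Qed.
Let Ff : web_filtered F. Proof. exact/web_filteredP/nfun_filtered. Qed.

Let act (X X' : CohI^n) (f : hom X X') (Y : CohI^k) :
  emb (papp F X Y) (papp F X' Y) := farr F (pcat_hom f (idm Y)).

Let act_nat (X X' : CohI^n) (f : hom X X') (Y Y' : CohI^k) (g : hom Y Y') x :
  act f Y' ((farr (papp F X) g : emb _ _) x) =
  (farr (papp F X') g : emb _ _) (act f Y x).
Proof.
rewrite /act.
have H : farr F (cmp (pcat_hom f (idm Y')) (pcat_hom (idm X) g)) =
    farr F (cmp (pcat_hom (idm X') g) (pcat_hom f (idm Y))).
  by rewrite -!pcat_homM !cmp1f !cmpf1.
rewrite !farrM in H; exact: (emb_ext H x).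
Qed.

Lemma pullback_idl (A D : coh) (f : emb A D) :
  pullback_on_web f (emb_id D) (emb_id A) f.
Proof. by split=> // a b e; exists a. Qed.

Lemma pullback_idr (A D : coh) (f : emb A D) :
  pullback_on_web (emb_id D) f f (emb_id A).
Proof. by split=> // a b e; exists b. Qed.

Lemma push_min (X X' : CohI^n) (f : hom X X') (a : nform (papp F X))
    (Z : CohI^k) (h : hom Z (coh_of_fins (nf_sp a))) (z : web (papp F X' Z)) :
  (farr (papp F X') h : emb _ _) z = act f _ (nf_pt a) -> is_iso h.
Proof.
move=> E.
have [|w [_ wa]] := @Fp _ _ _ _ (pcat_hom (idm X') h) (pcat_hom f (idm _))
    (pcat_hom f (idm Z)) (pcat_hom (idm X) h) _ _ _ E.
  by apply: pcat_pullback => i; [apply: pullback_idr|apply: pullback_idl].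
exact: (@nf_min _ _ a _ h w).
Qed.

Definition push (X X' : CohI^n) (f : hom X X') (a : nform (papp F X)) :
    nform (papp F X') :=
  @NForm k (papp F X') (nf_sp a) (act f _ (nf_pt a)) (@push_min X X' f a).

Lemma push_iso (X X' : CohI^n) (f : hom X X') a b :
  nf_iso (push f a) (push f b) <-> nf_iso a b.
Proof.
split=> -[t [ti E]]; exists t; split=> //.
  by apply: (@emb_inj _ _ (act f _)); rewrite act_nat.
by rewrite -[nf_pt (push f a)]/(act f _ (nf_pt a)) -act_nat E.
Qed.

Lemma push_coh (X X' : CohI^n) (f : hom X X') a b :
  nf_coh (push f a) (push f b) <-> nf_coh a b.
Proof.
split=> H Z g h.
  rewrite -(emb_coh (act f Z)) !act_nat; exact: H.
rewrite -[nf_pt (push f a)]/(act f _ (nf_pt a)).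
rewrite -[nf_pt (push f b)]/(act f _ (nf_pt b)) -!act_nat.
by rewrite emb_coh.
Qed.

Lemma push_class (X X' : CohI^n) (f : hom X X') (C : Tr (papp F X)) :
  exists b, nf_coh b b /\
    [set b | exists a, sval C a /\ nf_iso (push f a) b] = nf_iso b.
Proof.
have [a [aa ->]] := nf_class_surj C.
exists (push f a); split; first by rewrite push_coh.
apply/funext => b; apply/propext; split=> [[a' [/= aa' /nf_iso_trans]]|].
  by move=> H; apply: (nf_iso_trans _ (H _ (nf_iso_refl _))); rewrite push_iso.
by move=> ab; exists a; split=> //; apply: nf_iso_refl.
Qed.

Definition trace_map (X X' : CohI^n) (f : hom X X') (C : Tr (papp F X)) :
    Tr (papp F X') :=
  exist _ [set b | exists a, sval C a /\ nf_iso (push f a) b] (push_class f C).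

Lemma trace_map_class (X X' : CohI^n) (f : hom X X') a aa aa' :
  trace_map f (@nf_class _ _ a aa) = @nf_class _ _ (push f a) aa'.
Proof.
apply: sval_inj; apply/funext => b; apply/propext; split=> [[a' [/= H]]|].
  by apply: nf_iso_trans; rewrite push_iso.
by move=> ab; exists a; split=> //; apply: nf_iso_refl.
Qed.

Definition trace_emb (X X' : CohI^n) (f : hom X X') :
  emb (Tr (papp F X)) (Tr (papp F X')).
Proof.
apply: (@Emb _ _ (trace_map f)).
  move=> C D; have [a [aa ->]] := nf_class_surj C.
  have [b [bb ->]] := nf_class_surj D.
  have aa' := (push_coh f a a).2 aa; have bb' := (push_coh f b b).2 bb.
  rewrite !trace_map_class => /nf_class_inj /push_iso; exact: nf_class_eq.
move=> C D; have [a [aa ->]] := nf_class_surj C.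
have [b [bb ->]] := nf_class_surj D.
have aa' := (push_coh f a a).2 aa; have bb' := (push_coh f b b).2 bb.
by rewrite !trace_map_class !nf_class_coh push_coh.
Defined.

Definition forall_functor : functor CohI^n CohI.
Proof.
apply: (@Functor CohI^n CohI (fun X => Tr (papp F X)) (fun X Y f => trace_emb f)).
  move=> X; apply: emb_eq => C /=; have [a [aa ->]] := nf_class_surj C.
  rewrite trace_map_class ?push_coh // => aa'; apply: nf_class_eq.
  exists (idm _); split; first by exists (idm _); rewrite cmp1f.
  by rewrite farr1 /= /act pcat_hom1 farr1.
move=> X Y Z g f; apply: emb_eq => C /=; have [a [aa ->]] := nf_class_surj C.
have aa' := (push_coh f a a).2 aa; have aa'' := (push_coh g _ _).2 aa'.
have bb := (push_coh (cmp g f) a a).2 aa.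
rewrite !trace_map_class; apply: nf_class_eq.
exists (idm _); split; first by exists (idm _); rewrite cmp1f.
rewrite farr1 /= /act.
have -> : pcat_hom (cmp g f) (idm (coh_of_fins (nf_sp a))) =
    cmp (pcat_hom g (idm _)) (pcat_hom f (idm _)) by rewrite -pcat_homM cmp1f.
by rewrite farrM.
Defined.

Lemma forall_pullbacks : web_pullbacks forall_functor.
Proof.
move=> X1 X2 X3 X0 f g p q pb C D.
have [a [aa ->]] := nf_class_surj C; have [b [bb ->]] := nf_class_surj D.
have aa' := (push_coh f a a).2 aa; have bb' := (push_coh g b b).2 bb.
rewrite /= !trace_map_class => /nf_class_inj [t [ti E]].
pose ta := (farr (papp F X1) t : emb _ _) (nf_pt a).
have {}E : act f _ ta = act g _ (nf_pt b) by rewrite act_nat.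
have [|w [wa wb]] := @Fp _ _ _ _ (pcat_hom f (idm _)) (pcat_hom g (idm _))
    (pcat_hom p (idm _)) (pcat_hom q (idm _)) _ _ _ E.
  by apply: pcat_pullback => i //; apply: (@pullback_idl _ _ (emb_id _)).
have wm (Z : CohI^k) (h : hom Z (coh_of_fins (nf_sp b))) (z : web (papp F X0 Z)) :
    (farr (papp F X0) h : emb _ _) z = w -> is_iso h.
  move=> e; apply: (@nf_min _ _ b _ h (act q Z z)).
  by rewrite -act_nat e.
pose c := NForm wm.
have qc : nf_iso (push q c) b.
  exists (idm _); split; first by exists (idm _); rewrite cmp1f.
  by rewrite farr1.
have pc : nf_iso (push p c) a.
  apply: nf_iso_sym; exists t; split=> //.
have cc : nf_coh c c.
  by rewrite -(push_coh q); apply: (nf_coh_iso _ _ bb); apply: nf_iso_sym.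
exists (nf_class cc).
have pcc := (push_coh p c c).2 cc; have qcc := (push_coh q c c).2 cc.
by rewrite !trace_map_class; split; apply: nf_class_eq.
Qed.

Lemma forall_filtered : web_filtered forall_functor.
Proof.
move=> J fJ D L c cc cs C; have [a [aa ->]] := nf_class_surj C.
pose Y := coh_of_fins (nf_sp a).
have D1 j : pcat_hom (farr D (idm j)) (idm Y) = idm (pcat (D j) Y).
  by rewrite farr1 pcat_hom1.
have DM i j l (v : hom j l) (u : hom i j) :
    pcat_hom (farr D (cmp v u)) (idm Y) =
    cmp (pcat_hom (farr D v) (idm Y)) (pcat_hom (farr D u) (idm Y)).
  by rewrite farrM -pcat_homM cmp1f.
pose D' := @Functor J CohI^(n + k) (fun j => pcat (D j) Y)
  (fun i j u => pcat_hom (farr D u) (idm Y)) D1 DM.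
pose c' j : hom (D' j) (pcat L Y) := pcat_hom (c j) (idm Y).
have cc' : is_cocone c'.
  move=> i j u; apply: etrans (esym (pcat_homM (c j) (farr D u) (idm Y) (idm Y))) _.
  by rewrite cc cmp1f.
have cs' i : jointly_surjective (fun j => c' j i).
  rewrite /jointly_surjective /c' /= /pcat_hom /pcat; case: split => m.
    exact: cs.
  by case: fJ => -[j _] _ _ x; exists j, x.
have [j [w wa]] := Ff fJ cc' cs' (nf_pt a).
have wm (Z : CohI^k) (h : hom Z Y) (z : web (papp F (D j) Z)) :
    (farr (papp F (D j)) h : emb _ _) z = w -> is_iso h.
  move=> e; apply: (@nf_min _ _ a _ h (act (c j) Z z)).
  by rewrite -act_nat e.
pose b : nform (papp F (D j)) := @NForm _ (papp F (D j)) (nf_sp a) w wm.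
have ba : nf_iso (push (c j) b) a.
  exists (idm _); split; first by exists (idm _); rewrite cmp1f.
  by rewrite farr1.
have bb : nf_coh b b.
  by rewrite -(push_coh (c j)); apply: (nf_coh_iso _ _ aa); apply: nf_iso_sym.
exists j, (nf_class bb); have bb' := (push_coh (c j) b b).2 bb.
by rewrite /= trace_map_class; apply: nf_class_eq.
Qed.

Definition nforall : normal_functor n := mk_normal forall_pullbacks forall_filtered.
End Forall.

(* Formulas with free variables in ['I_n], in negation normal form;
   a quantifier binds the last variable. *)
Inductive mall2 : nat -> Type :=
| MVar n : 'I_n -> mall2 n
| MNVar n : 'I_n -> mall2 n
| MOne n : mall2 n
| MBot n : mall2 n
| MTensor n : mall2 n -> mall2 n -> mall2 n
| MPar n : mall2 n -> mall2 n -> mall2 n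
| MZero n : mall2 n
| MTop n : mall2 n
| MPlus n : mall2 n -> mall2 n -> mall2 n
| MWith n : mall2 n -> mall2 n -> mall2 n
| MForall n : mall2 (n + 1) -> mall2 n
| MExists n : mall2 (n + 1) -> mall2 n.

Fixpoint interp n (A : mall2 n) : normal_functor n :=
  match A with
  | MVar _ i => nvar i
  | MNVar _ i => ndual (nvar i)
  | MOne n => nconst n unit_coh
  | MBot n => ndual (nconst n unit_coh)
  | MTensor _ A B => ntensor (interp A) (interp B)
  | MPar _ A B => ndual (ntensor (ndual (interp A)) (ndual (interp B)))
  | MZero n => nconst n empty_coh
  | MTop n => ndual (nconst n empty_coh)
  | MPlus _ A B => nplus (interp A) (interp B)
  | MWith _ A B => ndual (nplus (ndual (interp A)) (ndual (interp B)))
  | MForall _ A => nforall (interp A)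
  | MExists _ A => ndual (nforall (ndual (interp A)))
  end.

Definition mall2_definable n (F : normal_functor n) : Prop :=
  exists A : mall2 n, F = interp A.

(* [Some b] is a bit and [None] a separator. *)
Definition symbol : Type := option bool.

Inductive cell := LeftEnd | RightEnd | Letter of symbol.
Inductive move := MLeft | MStay | MRight.

(* Deterministic Turing transducers: a two-way read-only input tape with end
   markers, [tapes] one-way infinite work tapes, and a write-only output tape;
   the machine halts when [trans] returns [None]. *)
Record machine := Machine {
  state : finType;
  wsym : finType;
  tapes : nat;
  start : state;
  blank : wsym;
  trans : state -> cell -> {ffun 'I_tapes -> wsym} ->
    option (state * move * {ffun 'I_tapes -> wsym * move} * option symbol) }.

Section Run.
Variables (M : machine) (w : seq symbol).

Record config := Config {
  cstate : state M;
  cinput : nat;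
  ctape : 'I_(tapes M) -> nat -> wsym M;
  chead : 'I_(tapes M) -> nat;
  cout : seq symbol }.

Definition initial : config :=
  Config (start M) 0 (fun _ _ => blank M) (fun _ => 0) [::].

Definition read_input (p : nat) : cell :=
  if p is p'.+1 then
    (if onth w p' is Some s then Letter s else RightEnd)
  else LeftEnd.

Definition shift (m : move) (p : nat) : nat :=
  match m with MLeft => p.-1 | MStay => p | MRight => p.+1 end.

Definition step (c : config) : option config :=
  if trans (cstate c) (read_input (cinput c)) [ffun i => ctape c i (chead c i)]
    is Some (q, m, a, o) then
    Some (Config q
      (minn (shift m (cinput c)) (size w).+1)
      (fun i p => if p == chead c i then (a i).1 else ctape c i p)
      (fun i => shift (a i).2 (chead c i))
      (if o is Some s then rcons (cout c) s else cout c))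
  else None.

Definition config_at (t : nat) : config :=
  iter t (fun c => odflt c (step c)) initial.

Definition outputs (v : seq symbol) : Prop :=
  exists t, step (config_at t) = None /\ cout (config_at t) = v.

Definition runs_in_space (s : nat) : Prop :=
  forall t i, chead (config_at t) i < s.
End Run.

Definition logspace_computable (T : Type) (enc : T -> seq symbol)
    (f : T -> seq symbol) : Prop :=
  exists (M : machine) (k : nat), forall x : T,
    outputs M (enc x) (f x) /\
    runs_in_space M (enc x) (k * (trunc_log 2 (size (enc x))).+1).

(* The rows of the adjacency matrix, each one ended by a separator, then one
   more separator. *)
Definition encode_graph m (r : rel 'I_m) : seq symbol :=
  rcons (flatten [seq rcons [seq Some (r x y) | y <- enum 'I_m] None
                 | x <- enum 'I_m]) None.

Definition encode_input n (X : 'I_n -> fincoh) : seq symbol :=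
  flatten [seq encode_graph (@fadj (X i)) | i <- enum 'I_n].

Definition encode_nat (k : nat) : seq symbol := rcons (nseq k (Some true)) None.

(* A concrete presentation of the spaces [F X], for [X] finite: a finite list
   of pairwise non-isomorphic normal forms [(Y_j |- y_j)] and, for each [X], an
   enumeration without repetition of the points of [F X], each one given as
   [F(i)(y_j)] for an explicit index [j] and embedding [i : Y_j -> X]. *)
Record presentation n (F : functor CohI^n CohI) := Presentation {
  pnum : nat;
  pnf : 'I_pnum -> nform F;
  pnf_inj : forall j l, nf_iso (pnf j) (pnf l) -> j = l;
  pcard : ('I_n -> fincoh) -> nat;
  pcode : forall X : 'I_n -> fincoh, 'I_(pcard X) ->
    {j : 'I_pnum & hom (coh_of_fins (nf_sp (pnf j))) (coh_of_fins X)};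
  ppoint := (fun (X : 'I_n -> fincoh) (p : 'I_(pcard X)) =>
    (farr F (projT2 (pcode p)) : emb _ _) (nf_pt (pnf (projT1 (pcode p))))
    : web (F (coh_of_fins X)));
  ppoint_bij : forall X : 'I_n -> fincoh, bijective (@ppoint X) }.

Section Encode.
Variables (n : nat) (F : functor CohI^n CohI) (P : presentation F).

Definition encode_embedding (Y X : 'I_n -> fincoh)
    (f : hom (coh_of_fins Y) (coh_of_fins X)) : seq symbol :=
  flatten [seq flatten [seq encode_nat ((f i : emb _ _) a : 'I_(fcard (X i)))
                       | a <- enum 'I_(fcard (Y i))]
          | i <- enum 'I_n].

Definition encode_point (X : 'I_n -> fincoh) (p : 'I_(pcard P X)) : seq symbol :=
  encode_nat (projT1 (pcode p)) ++ encode_embedding (projT2 (pcode p)).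

(* The coherence matrix of [F X], then the list of its points. *)
Definition encode_value (X : 'I_n -> fincoh) : seq symbol :=
  encode_graph (fun p q : 'I_(pcard P X) => `[< cohr (ppoint p) (ppoint q) >]) ++
  flatten [seq encode_point p | p <- enum 'I_(pcard P X)].

(* A subset of [F X] as a bit vector, in the order of the list of points. *)
Definition encode_subset (X : 'I_n -> fincoh) (S : set (web (F (coh_of_fins X)))) :
    seq symbol :=
  [seq Some `[< S (ppoint p) >] | p <- enum 'I_(pcard P X)].
End Encode.

(* Main.v *)
From mathcomp Require Import zify order.
Require Import Defs.

Set Implicit Arguments.
Unset Strict Implicit.
Unset Printing Implicit Defensive.

(** Every point of [F X] is [F(i)(y)] for a normal form [(Y |- y)] and an
    embedding [i : Y -> X], unique up to the automorphisms of [(Y |- y)].  Since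
    [F] preserves finiteness and has finite degree, there are only finitely many
    normal forms up to isomorphism: they all embed into one finite universal
    space [U], and are told apart by their images in the finite web of [F U].
    Hence a point of [F X] is a bounded tuple of vertices of [X], made unique by
    taking it lexicographically minimal in its orbit.  As embeddings preserve
    and reflect coherence, both the validity of a tuple and the coherence of two
    points depend only on the order and adjacency relations between the vertices
    involved, a finite amount of information.  So the output is produced by a
    constant number of nested loops over the vertices of [X], with a finite
    decision tree inside.  Such loop programs, whose counters are bounded by the
    length of the input, run in logarithmic space with binary counters. *)

(** * Loop programs and their simulation by Turing machines *)

(** The decision trees are not extracted from [F]. The tables [good] and [coherence_bit] quantify
    classically over all inputs, and the program for a fixed [F] merely contains their finitely many
    relevant values. What has to be proved is that such a table is right at every input: a pattern
    seen once decides all its occurrences, which is the content of [transfer] and [transfer_cohr].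
    Validity includes lexicographic minimality, so it must be visible in a pattern too. This is why
    patterns record the order of the vertices besides their adjacency: the order decides equality of
    vertices and also the comparison of a tuple with its images under the automorphisms. Finally, a
    presentation may list the points in any order, so they are listed in the order in which the
    loops meet them, and no sorting or searching takes place. *)

Definition store := nat -> nat.

Definition upd (r v : nat) (s : store) : store :=
  fun x => if x == r then v else s x.

(* Register [0] is the position of the input head, the others are counters. *)
Inductive node :=
| Out of symbol | Inc of nat | Dec of nat | Nonzero of nat
| Cell of (cell -> bool).

Inductive cmd :=
| Do of node
| Seq of cmd & cmd
| If of node & cmd & cmd
| Loop of cmd & node & cmd.

Section Semantics.
Variable w : seq symbol.

(** The bound on [Inc] keeps every register at most [(size w).+1], the position of the right end
    marker and the largest value for which a counter has room. Positivity under [Dec] ensures that a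
    binary decrement finds a one to borrow from. *)
Definition node_ok (a : node) (s : store) : bool :=
  match a with Inc r => s r <= size w | Dec r => 0 < s r | _ => true end.

Definition answer (a : node) (s : store) : bool :=
  match a with
  | Nonzero r => s r != 0 | Cell P => P (read_input w (s 0)) | _ => true
  end.

Definition node_next (a : node) (s : store) : store :=
  match a with
  | Inc r => upd r (s r).+1 s | Dec r => upd r (s r).-1 s | _ => s
  end.

Definition node_out (a : node) : seq symbol :=
  if a is Out x then [:: x] else [::].

(** [Loop c a d] has its exit in the middle: [c] runs before every test, the failing one included,
    so that a loop can move the input head to the place where its test must look. *)
Inductive exec : cmd -> store -> store -> seq symbol -> Prop :=
| exec_do a s : node_ok a s -> exec (Do a) s (node_next a s) (node_out a)
| exec_seq c d s s' s'' o o' :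
    exec c s s' o -> exec d s' s'' o' -> exec (Seq c d) s s'' (o ++ o')
| exec_if a c d s s' o :
    node_ok a s -> exec (if answer a s then c else d) (node_next a s) s' o ->
    exec (If a c d) s s' (node_out a ++ o)
| exec_stop c a d s s' o :
    exec c s s' o -> node_ok a s' -> answer a s' = false ->
    exec (Loop c a d) s (node_next a s') (o ++ node_out a)
| exec_loop c a d s s1 s2 s3 o1 o2 o3 :
    exec c s s1 o1 -> node_ok a s1 -> answer a s1 = true ->
    exec d (node_next a s1) s2 o2 -> exec (Loop c a d) s2 s3 o3 ->
    exec (Loop c a d) s s3 (o1 ++ node_out a ++ o2 ++ o3).
End Semantics.

(** * Flow charts and compilation *)

Record flow := Flow {
  fstate : finType;
  fstart : fstate;
  fnode : fstate -> node;
  fnext : fstate -> bool -> option fstate }.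

Inductive run (w : seq symbol) (G : flow) :
    option (fstate G) -> store -> store -> seq symbol -> Prop :=
| run_stop s : run w None s s [::]
| run_go q s s' o :
    node_ok w (fnode q) s ->
    run w (fnext q (answer w (fnode q) s)) (node_next (fnode q) s) s' o ->
    run w (Some q) s s' (node_out (fnode q) ++ o).

(** Here [G] is a part of [H] whose exits are redirected to [k]. Each inductive case of [exec_run]
    glues its subprograms by this lemma. *)
Lemma run_lift w (G H : flow) (h : fstate G -> fstate H)
    (k : option (fstate H)) :
  (forall q, fnode (h q) = fnode q) ->
  (forall q b, fnext (h q) b = if fnext q b is Some q' then Some (h q') else k) ->
  forall q s s' s'' o o', run w (Some q) s s' o -> run w k s' s'' o' ->
  run w (Some (h q)) s s'' (o ++ o').
Proof.
move=> hn hx q s s' s'' o o' R Rk.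
suff L p u v y : run w p u v y -> run w k v s'' o' ->
    run w (if p is Some p' then Some (h p') else k) u s'' (y ++ o').
  exact: L R Rk.
elim=> {p u v y} // p u v y ok _ IH /IH {}IH.
rewrite -catA -(hn p); apply: run_go; first by rewrite hn.
by rewrite hx hn.
Qed.

Definition seq_flow (G H : flow) : flow :=
  @Flow (fstate G + fstate H)%type (inl (fstart G))
    (fun q => match q with inl q => fnode q | inr q => fnode q end)
    (fun q b => match q with
      | inl q => Some (if fnext q b is Some q' then inl q' else inr (fstart H))
      | inr q => omap inr (fnext q b) end).

Definition if_flow (a : node) (G H : flow) : flow :=
  @Flow (option (fstate G + fstate H)) None
    (fun q => match q with
      | None => a | Some (inl q) => fnode q | Some (inr q) => fnode q end)
    (fun q b => match q with
      | None => Some (Some (if b then inl (fstart G) else inr (fstart H)))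
      | Some (inl q) => omap (Some \o inl) (fnext q b)
      | Some (inr q) => omap (Some \o inr) (fnext q b) end).

Definition loop_flow (G : flow) (a : node) (H : flow) : flow :=
  @Flow (fstate G + option (fstate H))%type (inl (fstart G))
    (fun q => match q with
      | inl q => fnode q | inr None => a | inr (Some q) => fnode q end)
    (fun q b => match q with
      | inl q => Some (if fnext q b is Some q' then inl q' else inr None)
      | inr None => if b then Some (inr (Some (fstart H))) else None
      | inr (Some q) =>
        Some (if fnext q b is Some q' then inr (Some q') else inl (fstart G))
      end).

Fixpoint compile (c : cmd) : flow :=
  match c with
  | Do a => @Flow unit tt (fun=> a) (fun _ _ => None)
  | Seq c d => seq_flow (compile c) (compile d)
  | If a c d => if_flow a (compile c) (compile d)
  | Loop c a d => loop_flow (compile c) a (compile d)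
  end.

Lemma exec_run w c s s' o :
  exec w c s s' o -> run w (Some (fstart (compile c))) s s' o.
Proof.
elim=> {c s s' o} /=.
- by move=> a s ok; rewrite -[node_out a]cats0; apply: run_go => //; apply: run_stop.
- move=> c d s s' s'' o o' _ IHc _ IHd.
  pose H := seq_flow (compile c) (compile d).
  have {}IHd : @run w H (Some (inr (fstart (compile d)))) s' s'' o'.
    rewrite -[o']cats0.
    by apply: (@run_lift w (compile d) H inr None _ _ _ _ _ _ _ _ IHd (run_stop _ _ _)) => // q b /=; case: fnext.
  by apply: (@run_lift w (compile c) H inl _ _ _ _ _ _ _ _ _ IHc IHd) => // q b /=; case: fnext.
- move=> a c d s s' o ok _ IH; pose H := if_flow a (compile c) (compile d).
  apply: (@run_go w H None) => //=; rewrite -[o]cats0.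
  move: IH; case: answer => IH.
    by apply: (@run_lift w _ H (Some \o inl) None _ _ _ _ _ _ _ _ IH (run_stop _ _ _)) => // q b /=; case: fnext.
  by apply: (@run_lift w _ H (Some \o inr) None _ _ _ _ _ _ _ _ IH (run_stop _ _ _)) => // q b /=; case: fnext.
- move=> c a d s s' o _ IH ok e; pose H := loop_flow (compile c) a (compile d).
  have R : @run w H (Some (inr None)) s' (node_next a s') (node_out a).
    rewrite -[node_out a]cats0; apply: (@run_go w H (inr None)) => //=.
    by rewrite e; apply: run_stop.
  by apply: (@run_lift w _ H inl _ _ _ _ _ _ _ _ _ IH R) => // q b /=; case: fnext.
- move=> c a d s s1 s2 s3 o1 o2 o3 _ IHc ok e _ IHd _ IHl.
  pose H := loop_flow (compile c) a (compile d).
  have R : @run w H (Some (inr None)) s1 s3 (node_out a ++ o2 ++ o3).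
    apply: (@run_go w H (inr None)) => //=; rewrite e.
    by apply: (@run_lift w _ H (inr \o Some) _ _ _ _ _ _ _ _ _ IHd IHl) => // q b /=; case: fnext.
  by apply: (@run_lift w _ H inl _ _ _ _ _ _ _ _ _ IHc R) => // q b /=; case: fnext.
Qed.

(** * Binary counters *)

Fixpoint bits_val (l : seq bool) : nat :=
  if l is b :: l' then b + (bits_val l').*2 else 0.

(** Carry propagation: by this and [bits_val_zeros], adding one to $1^k0q$ gives $0^k1q$, since both
    sides evaluate to $2^k(2q+1)$. Read backwards, it is the borrow of a decrement. *)
Lemma bits_val_ones k l : (bits_val (nseq k true ++ l)).+1 = 2 ^ k * (bits_val l).+1.
Proof. by elim: k => [|k IH] /=; [rewrite mul1n|rewrite expnS; nia]. Qed.

Lemma bits_val_zeros k l : bits_val (nseq k false ++ l) = 2 ^ k * bits_val l.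
Proof. by elim: k => [|k IH] /=; [rewrite mul1n|rewrite expnS; nia]. Qed.

Lemma split_run (b : bool) l :
  exists k, l = nseq k b \/ exists q, l = nseq k b ++ ~~ b :: q.
Proof.
elim: l => [|c l [k IH]]; first by exists 0; left.
case: (eqVneq c b) => [->|/negPf cb].
  by exists k.+1; case: IH => [->|[q ->]]; [left|right; exists q].
by exists 0; right; exists l; move: cb; case: b c {IH} => -[].
Qed.

(* A counter is a tape [marker, bits, blank, ...], least significant bit
   first: [None] is the blank and [Some None] the marker. *)
Definition wcell : Type := option (option bool).

Definition digit (b : bool) : wcell := Some (Some b).

Definition counter (l : seq bool) : seq wcell := Some None :: map digit l.

Definition node_reg (a : node) : nat :=
  match a with Inc r | Dec r | Nonzero r => r | _ => 0 end.

(** The second component is [None] while the scan goes on, and the answer once it stops. An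
    increment treats a blank as a zero, which lengthens the counter by one digit; a zero test passes
    over zeros, and reaching the blank means that the value is zero. *)
Definition scan (a : node) (x : wcell) : wcell * option bool :=
  match a with
  | Inc _ => if x == digit true then (digit false, None) else (digit true, Some true)
  | Dec _ => if x == digit false then (digit true, None) else (digit false, Some true)
  | _ => if x == digit false then (x, None) else (x, Some (x != None))
  end.

Definition head_move (a : node) : move :=
  match a with Inc _ => MRight | Dec _ => MLeft | _ => MStay end.

Definition head_answer (a : node) (c : cell) : bool :=
  match a with
  | Nonzero _ => if c is LeftEnd then false else true
  | Cell P => P c
  | _ => true
  end.

(** * Simulation of a flow chart by a Turing machine *)

Section Machine.
Variable G : flow.

(** Tape [i] holds register [i]. Tape 0 holds no counter in use, as register 0 is the position of
    the input head. *)
Definition ntape : nat := (\max_(q : fstate G) node_reg (fnode q)).+1.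

(* Phases of the simulation of a node: start, scanning a counter rightwards,
   and returning to the marker with an answer.  [inl true] is the initial state
   and [inl false] the final one. *)
Definition mstate : finType := (bool + fstate G * option (option bool))%type.

Definition goto (q : option (fstate G)) : mstate :=
  if q is Some q' then inr (q', None) else inl false.

Definition on_tape (r : 'I_ntape) (f : {ffun 'I_ntape -> wcell}) (y : wcell)
    (m : move) : {ffun 'I_ntape -> wcell * move} :=
  [ffun i => if i == r then (y, m) else (f i, MStay)].

Definition mtrans (q : mstate) (c : cell) (f : {ffun 'I_ntape -> wcell}) :
    option (mstate * move * {ffun 'I_ntape -> wcell * move} * option symbol) :=
  match q with
  | inl true =>
    Some (goto (Some (fstart G)), MStay, [ffun=> (Some None, MStay)], None)
  | inl false => None
  | inr (s, ph) =>
    let a := fnode s in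
    let r := inord (node_reg a) in
    match ph with
    | None =>
      if node_reg a == 0 then
        Some (goto (fnext s (head_answer a c)), head_move a,
              [ffun i => (f i, MStay)], if a is Out x then Some x else None)
      else Some (inr (s, Some None), MStay, on_tape r f (f r) MRight, None)
    | Some None =>
      let y := scan a (f r) in
      if y.2 is Some b then
        Some (inr (s, Some (Some b)), MStay, on_tape r f y.1 MLeft, None)
      else Some (inr (s, Some None), MStay, on_tape r f y.1 MRight, None)
    | Some (Some b) =>
      if f r == Some None then
        Some (goto (fnext s b), MStay, on_tape r f (f r) MStay, None)
      else Some (inr (s, Some (Some b)), MStay, on_tape r f (f r) MLeft, None)
    end
  end.

Definition flow_machine : machine :=
  @Machine mstate wcell ntape (inl true) None mtrans.

Variables (w : seq symbol) (space : nat).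
Let N := size w.

Definition in_space (c : config flow_machine) : Prop :=
  forall i, chead c i < space.

Definition next_config (c : config flow_machine) := odflt c (step w c).

(** The space bound travels with reachability because it concerns all intermediate configurations,
    not only those between two nodes. *)
Definition reaches (P : config flow_machine -> Prop) (c : config flow_machine) :=
  exists k, P (iter k next_config c) /\
    forall t, t <= k -> in_space (iter t next_config c).

Lemma reaches_now (P : config flow_machine -> Prop) c :
  in_space c -> P c -> reaches P c.
Proof. by move=> cs Pc; exists 0; split=> // t; rewrite leqn0 => /eqP ->. Qed.

Lemma reaches_step (P : config flow_machine -> Prop) c c' :
  step w c = Some c' -> in_space c -> reaches P c' -> reaches P c.
Proof.
move=> e cs [k [Pk ks]]; exists k.+1.
have E t : iter t.+1 next_config c = iter t next_config c'.
  by rewrite iterSr /next_config e.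
by split; [rewrite E|case=> // t lt; rewrite E; apply: ks].
Qed.

Lemma halt_outputs s c :
  step w c = None -> reaches (fun c' => c' = c) (@initial flow_machine) ->
  space <= s ->
  outputs flow_machine w (cout c) /\ runs_in_space flow_machine w s.
Proof.
move=> e [k [E ks]] le; rewrite -E in e *; split; first by exists k.
suff H t : in_space (config_at flow_machine w t).
  by move=> t i; apply: leq_trans (H t i) le.
rewrite /config_at -/next_config.
case: (leqP t k) => [/ks //|kt].
rewrite -(subnK (ltnW kt)) iterD; move: e; set d := iter k _ _ => e.
have -> : iter (t - k) next_config d = d.
  by elim: (t - k) => //= u ->; rewrite /next_config e.
exact: ks.
Qed.

Definition conf (q : mstate) (p : nat) (T : 'I_ntape -> seq wcell)
    (h : 'I_ntape -> nat) (o : seq symbol) : config flow_machine :=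
  @Config flow_machine q p (fun i x => nth None (T i) x) h o.

Section Tape.
Variables (s : fstate G) (p : nat) (T : 'I_ntape -> seq wcell) (o : seq symbol).
Let a := fnode s.
Let r : 'I_ntape := inord (node_reg a).
Hypothesis pN : p <= N.+1.
Hypothesis ra : node_reg a != 0.
Hypothesis space_gt0 : 0 < space.

Definition tconf (q : mstate) (l : seq wcell) (x : nat) :=
  conf q p (fun i => if i == r then l else T i) (fun i => if i == r then x else 0) o.

Lemma tconf_in_space q l x : x < space -> in_space (tconf q l x).
Proof. by move=> xs i; rewrite /tconf /=; case: eqP. Qed.

Lemma step_tconf (q q' : mstate) (l l' : seq wcell) x y m :
  (forall f : {ffun 'I_ntape -> wcell}, f r = nth None l x -> mtrans q (read_input w p) f =
     Some (q', MStay, on_tape r f y m, None)) ->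
  (forall z, (if z == x then y else nth None l z) = nth None l' z) ->
  step w (tconf q l x) = Some (tconf q' l' (shift m x)).
Proof.
move=> Ht Hl; rewrite /step /=.
have -> := Ht [ffun i => nth None (if i == r then l else T i) (if i == r then x else 0)];
  last by rewrite ffunE eqxx.
congr Some; rewrite /tconf /conf; congr Config => /=.
- exact/minn_idPl.
- apply/funext => i; apply/funext => z; rewrite !ffunE.
  case: (i == r); first exact: Hl.
  by case: eqP => // ->.
- by apply/funext => i; rewrite ffunE; case: (i == r).
Qed.

Lemma reaches_scan (g : wcell -> wcell) l1 l2 l3 (P : _ -> Prop) :
  (forall x, x \in l2 -> scan a x = (g x, None)) ->
  size l1 + size l2 < space ->
  reaches P (tconf (inr (s, Some None)) (l1 ++ map g l2 ++ l3) (size l1 + size l2)) ->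
  reaches P (tconf (inr (s, Some None)) (l1 ++ l2 ++ l3) (size l1)).
Proof.
elim: l2 l1 => [|x l2 IH] l1 /= Hg lt R; first by move: R; rewrite addn0.
have gx : scan a x = (g x, None) by apply: Hg; rewrite mem_head.
apply: (@reaches_step _ _ (tconf (inr (s, Some None)) (rcons l1 (g x) ++ l2 ++ l3) (size l1).+1)).
- apply: (@step_tconf _ _ _ _ _ (g x) MRight) => [f fr|z] /=.
    by rewrite -/a -/r fr nth_cat ltnn subnn /= gx.
  rewrite cat_rcons !nth_cat; case: ltngtP => // [|->]; last by rewrite subnn.
  by move=> zl; rewrite -subnSK.
- by apply: tconf_in_space => //; apply: leq_ltn_trans lt; apply: leq_addr.
rewrite -(size_rcons l1 (g x)); apply: IH.
- by move=> y yl; apply: Hg; rewrite in_cons yl orbT.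
- by rewrite size_rcons addSnnS.
by move: R; rewrite size_rcons addSnnS cat_rcons.
Qed.

(** The marker occurs nowhere in [l], so the leftward walk stops exactly at cell 0. *)
Lemma reaches_return b l x (P : _ -> Prop) :
  x <= size l -> all (fun c => c != Some None) l -> x < space ->
  reaches P (conf (goto (fnext s b)) p (fun i => if i == r then Some None :: l else T i)
    (fun=> 0) o) ->
  reaches P (tconf (inr (s, Some (Some b))) (Some None :: l) x).
Proof.
move=> xl /allP al; elim: x xl => [|x IH] xl xs R.
  apply: (reaches_step _ _ R); last exact: tconf_in_space.
  have -> : conf (goto (fnext s b)) p (fun i => if i == r then Some None :: l else T i)
      (fun=> 0) o = tconf (goto (fnext s b)) (Some None :: l) (shift MStay 0).
    by congr conf; apply/funext => i; case: (i == r).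
  apply: (@step_tconf _ _ _ _ _ (Some None) MStay) => [f fr|[]//].
  by rewrite /= -/a -/r fr.
apply: (@reaches_step _ _ (tconf (inr (s, Some (Some b))) (Some None :: l) x)).
- apply: (@step_tconf _ _ _ _ _ (nth None l x) MLeft) => [f fr|z] /=.
    by rewrite -/a -/r fr /= (negPf (al _ (mem_nth _ xl))).
  by case: eqP => // ->.
- exact: tconf_in_space.
by apply: IH => //; apply: ltnW.
Qed.

(* The scan stops at the head of [l2], or at a blank when [l2] is empty. *)
Lemma reaches_counter (g : wcell -> wcell) b l1 l2 l3 (P : _ -> Prop) :
  T r = Some None :: l1 ++ l2 ->
  (forall x, x \in l1 -> scan a x = (g x, None)) ->
  (scan a (head None l2)).2 = Some b ->
  (forall z, nth None ((scan a (head None l2)).1 :: behead l2) z = nth None l3 z) ->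
  all (fun c => c != Some None) (map g l1 ++ l3) ->
  (size l1).+1 < space ->
  reaches P (conf (goto (fnext s b)) p
    (fun i => if i == r then Some None :: map g l1 ++ l3 else T i) (fun=> 0) o) ->
  reaches P (conf (inr (s, None)) p T (fun=> 0) o).
Proof.
move=> Tr Hg sb Hl al sp R.
have -> : conf (inr (s, None)) p T (fun=> 0) o = tconf (inr (s, None)) (T r) 0.
  by rewrite /tconf; congr conf; apply/funext => i; case: eqP => // ->.
rewrite Tr.
apply: (@reaches_step _ _ (tconf (inr (s, Some None)) (Some None :: l1 ++ l2) 1)).
- apply: (@step_tconf _ _ _ _ _ (Some None) MRight) => [f fr|[]//] /=.
  by rewrite -/a -/r fr /= (negPf ra).
- exact: tconf_in_space.
apply: (@reaches_scan g [:: Some None] l1 l2) => //.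
apply: (@reaches_step _ _ (tconf (inr (s, Some (Some b)))
    (Some None :: map g l1 ++ l3) (size l1))).
- have -> : size l1 = shift MLeft (size l1).+1 by [].
  apply: (@step_tconf _ _ _ _ _ (scan a (head None l2)).1 MLeft) => [f fr|z] /=.
    rewrite -/a -/r fr add1n /= nth_cat size_map ltnn subnn nth0.
    by rewrite sb.
  case: z => [|z]; first by rewrite add1n.
  rewrite add1n eqSS /= !nth_cat size_map; case: ltngtP => // [zl|->].
    by rewrite -Hl -(subnSK zl) /= nth_behead.
  by rewrite subnn -Hl.
- exact: tconf_in_space.
by apply: reaches_return => //; [rewrite size_cat size_map leq_addr|apply: ltnW].
Qed.
End Tape.

(** The number of bits of [N.+1], the largest value of a register. A work head visits the marker at
    0, at most [maxbits] digits, and the blank at [maxbits.+1]; hence the bound [space_ge] below. *)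
Definition maxbits : nat := (trunc_log 2 N.+1).+1.

Hypothesis space_ge : maxbits.+1 < space.

(** A decrement does not shorten a counter, so the top digits may be zeros and the width must be
    bounded separately from the value. *)
Definition represents (v : store) (T : 'I_ntape -> seq wcell) : Prop :=
  forall i, exists l, [/\ T i = counter l, size l <= maxbits &
    i != 0 :> nat -> bits_val l = v i].

Lemma node_reg_ltn (s : fstate G) : node_reg (fnode s) < ntape.
Proof. by rewrite ltnS; apply: (leq_bigmax (F := fun q => node_reg (fnode q))). Qed.

Lemma represents_upd v T (s : fstate G) l x :
  represents v T -> size l <= maxbits -> bits_val l = x ->
  represents (upd (node_reg (fnode s)) x v)
    (fun i => if i == inord (node_reg (fnode s)) then counter l else T i).
Proof.
move=> R ls lx i; rewrite /upd.
have -> : (i == node_reg (fnode s) :> nat) = (i == inord (node_reg (fnode s))).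
  by rewrite -val_eqE /= inordK // node_reg_ltn.
by case: eqP => _; [exists l|apply: R].
Qed.

Lemma upd_id r (v : store) : upd r (v r) v = v.
Proof. by apply/funext => x; rewrite /upd; case: eqP => // ->. Qed.

Lemma digits_unmarked l : all (fun c => c != Some None) (map digit l).
Proof. by elim: l. Qed.

Lemma reaches_node s v T o (P : _ -> Prop) :
  let a := fnode s in
  node_ok w a v -> v 0 <= N.+1 -> represents v T ->
  (forall T', represents (node_next a v) T' ->
    reaches P (conf (goto (fnext s (answer w a v))) (node_next a v 0) T'
      (fun=> 0) (o ++ node_out a))) ->
  reaches P (conf (inr (s, None)) (v 0) T (fun=> 0) o).
Proof.
move=> a ok v0 R H.
have sp0 : 0 < space by apply: leq_ltn_trans space_ge.
case: (eqVneq (node_reg a) 0) => [ra|ra].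
  apply: reaches_step (H T _) => //; last first.
    move: ra ok; rewrite /a; case: fnode => //= r -> _ i;
      have [l [? ? lv]] := R i; exists l; split=> // i0;
      by rewrite lv // /upd (negPf i0).
  rewrite /step /= -/a ra eqxx /=; congr Some; rewrite /conf; congr Config.
  - congr goto; congr fnext; move: ra; rewrite /a; case: fnode => //= r -> /=.
    by case: (v 0) => //= k; case: onth.
  - move: ra ok; rewrite /a; case: fnode => /=; rewrite /upd /=.
    + by move=> *; apply/minn_idPl.
    + by move=> r -> /= ok; apply/minn_idPl; rewrite ltnS.
    + by move=> r -> /= ok; apply/minn_idPl; apply: leq_trans (leq_pred _) _.
    + by move=> *; apply/minn_idPl.
    + by move=> *; apply/minn_idPl.
  - by apply/funext => i; apply/funext => z; rewrite !ffunE; case: eqP => // ->.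
  - by apply/funext => i; rewrite ffunE.
  - by move: ra ok; rewrite /a; case: fnode => //= *; rewrite ?cats0 ?cats1.
have rn : (inord (node_reg a) : 'I_ntape) = node_reg a :> nat.
  by rewrite inordK // node_reg_ltn.
have [l [Tl ls]] := R (inord (node_reg a)); rewrite rn => /(_ ra) lv.
have v'0 : node_next a v 0 = v 0.
  by move: ra; rewrite /a; case: fnode => //= r; rewrite /upd eq_sym => /negPf ->.
have no : node_out a = [::] by move: ra; rewrite /a; case: fnode.
have {}H l' : size l' <= maxbits -> node_next a v = upd (node_reg a) (bits_val l') v ->
    reaches P (conf (goto (fnext s (answer w a v))) (v 0)
      (fun i => if i == inord (node_reg a) then counter l' else T i) (fun=> 0) o).
  move=> l's e; move: (H (fun i => if i == inord (node_reg a) then counter l' else T i)).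
  by rewrite v'0 no cats0; apply; rewrite e; apply: represents_upd.
(* The three counter operations share one shape: a block of [k] digits [d] is rewritten to [e], and
   the scan stops in [m], which becomes [m']. *)
have key k d e m m' b : l = nseq k d ++ m -> scan a (digit d) = (digit e, None) ->
    (scan a (head None (map digit m))).2 = Some b ->
    (forall z, nth None ((scan a (head None (map digit m))).1 :: behead (map digit m)) z =
      nth None (map digit m') z) ->
    answer w a v = b -> size (nseq k e ++ m') <= maxbits ->
    node_next a v = upd (node_reg a) (bits_val (nseq k e ++ m')) v ->
    reaches P (conf (inr (s, None)) (v 0) T (fun=> 0) o).
  move=> lE sd sb Hm ab l's vE; have := H _ l's vE.
  rewrite ab /counter map_cat map_nseq => R'.
  apply: (@reaches_counter s (v 0) T o v0 ra sp0 (fun=> digit e) b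
      (nseq k (digit d)) (map digit m) (map digit m')) => //.
  - by rewrite Tl lE /counter map_cat map_nseq.
  - by move=> x; rewrite mem_nseq => /andP [_ /eqP ->].
  - by rewrite map_nseq all_cat digits_unmarked all_nseq orbT.
  - rewrite size_nseq; apply: leq_ltn_trans space_ge; rewrite ltnS.
    by apply: leq_trans ls; rewrite lE size_cat size_nseq leq_addr.
  by rewrite map_nseq.
have bsz k d e (q : seq bool) b c : l = nseq k d ++ b :: q -> size (nseq k e ++ c :: q) <= maxbits.
  by move=> lE; move: ls; rewrite lE !size_cat !size_nseq.
move: ra ok lv key; rewrite /a; case: fnode => //= r _ ok lv key.
- have [k [lk|[q lk]]] := split_run true l.
    have vk : (v r).+1 = 2 ^ k by rewrite -lv lk -[nseq _ _]cats0 bits_val_ones /= muln1.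
    apply: (key k true false [::] [:: true] true) => //; first by rewrite cats0.
      (* The only case where a counter grows: all its digits are ones, so the new value is [2 ^ k],
         at most [N.+1], and [k.+1] digits fit. *)
      rewrite size_cat size_nseq addn1 ltnS; apply: trunc_log_max => //.
      by rewrite -vk ltnS.
    by rewrite bits_val_zeros /= muln1 vk.
  apply: (key k true false (false :: q) (true :: q) true) => //; first exact: bsz lk.
  by rewrite -lv lk bits_val_zeros bits_val_ones.
- have [k [lk|[q lk]]] := split_run false l.
    by move: ok; rewrite -lv lk -[nseq _ _]cats0 bits_val_zeros muln0.
  apply: (key k false true (true :: q) (false :: q) true) => //; first exact: bsz lk.
  have e : bits_val (true :: q) = (bits_val (false :: q)).+1 by [].
  by rewrite -lv lk bits_val_zeros e -bits_val_ones.
- have [k [lk|[q lk]]] := split_run false l.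
    apply: (key k false false [::] [::] false) => //; rewrite ?cats0 -?lk //.
    - by case=> // z; rewrite nth_default.
    - by rewrite -lv lk -[nseq _ _]cats0 bits_val_zeros muln0.
    - by rewrite lv upd_id.
  apply: (key k false false (true :: q) (true :: q) true) => //; rewrite -?lk //.
    rewrite -lv lk bits_val_zeros /=.
    by rewrite muln_eq0 expn_eq0.
  by rewrite lv upd_id.
Qed.

Lemma reaches_run q v v' o o' T :
  run w q v v' o -> v 0 <= N.+1 -> represents v T ->
  reaches (fun c => exists p T', c = conf (inl false) p T' (fun=> 0) (o' ++ o))
    (conf (goto q) (v 0) T (fun=> 0) o').
Proof.
have sp0 : 0 < space by apply: leq_ltn_trans space_ge.
move=> Rn; elim: Rn o' T => {q v v' o} [v|q v v' o ok Rn IH] o' T v0 R.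
  by apply: reaches_now => //; exists (v 0), T; rewrite cats0.
apply: (reaches_node ok v0 R) => T' R'.
rewrite catA; apply: IH => //.
by move: ok v0; case: fnode => //= r; rewrite /upd; case: eqP => // <- //=; lia.
Qed.

Lemma flow_machine_correct v' o :
  run w (Some (fstart G)) (fun=> 0) v' o ->
  outputs flow_machine w o /\ runs_in_space flow_machine w space.
Proof.
have sp0 : 0 < space by apply: leq_ltn_trans space_ge.
move=> Rn; pose T : 'I_ntape -> seq wcell := fun=> counter [::].
have R0 : represents (fun=> 0) T by move=> i; exists [::].
have := @reaches_run _ _ _ _ [::] T Rn (leq0n _) R0.
move=> [k [[p [T' E]] ks]].
(* The first machine step writes the markers; a marker followed by no digit is the counter of value
   zero. *)
have s0 : step w (@initial flow_machine) = Some (conf (goto (Some (fstart G))) 0 T (fun=> 0) [::]).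
  rewrite /step /=; congr Some; rewrite /conf; congr Config.
    by apply/funext => i; apply/funext => -[|z]; rewrite ffunE //= nth_nil.
  by apply/funext => i; rewrite ffunE.
apply: (@halt_outputs _ (conf (inl false) p T' (fun=> 0) o)) => //.
by apply: reaches_step s0 _ _ => //; exists k.
Qed.
End Machine.

Theorem exec_logspace (T : Type) (enc f : T -> seq symbol) (c : cmd) :
  (forall x, exists v, exec (enc x) c (fun=> 0) v (f x)) ->
  logspace_computable enc f.
Proof.
(* With $L$ the logarithm of the input size, [maxbits.+1] is at most $L+3$, which is below $4(L+1)$;
   a factor 3 would fail at $L=0$. *)
move=> H; exists (flow_machine (compile c)), 4 => x.
have [v /exec_run R] := H x; apply: flow_machine_correct R.
rewrite /maxbits; case: (posnP (size (enc x))) => [->//|s0].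
have: trunc_log 2 (size (enc x)).+1 <= (trunc_log 2 (size (enc x))).+1.
  rewrite -ltnS -(ltn_exp2l _ _ (isT : 1 < 2)).
  have := trunc_log_bounds (isT : 1 < 2) s0.
  have := trunc_logP (isT : 1 < 2) (ltn0Sn (size (enc x))).
  by move=> h /andP [_ h']; rewrite expnS; lia.
lia.
Qed.

(** * Programs for finite coherence spaces *)

Ltac store_eq :=
  apply/funext => ?; rewrite /upd ?eqxx;
  repeat (case: eqP => ? //; subst => //); try congruence; lia.

Lemma flatten_nils (T I : Type) (l : seq I) : flatten [seq [::] : seq T | _ <- l] = [::].
Proof. by elim: l. Qed.

(** Register conventions: 0 is the input head, 1 is scratch for [repeat_cmd], 2 is scratch for
    [if_le], and loop variables start at 3. High-level commands begin and end with the first three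
    at zero. *)
Definition skip : cmd := Do (Nonzero 0).
Definition clear (r : nat) : cmd := Loop skip (Nonzero r) (Do (Dec r)).
Definition rewind : cmd := clear 0.

(* Runs [c] as many times as the value of [r], which is saved in the temporary
   register [1] and restored. *)
Definition repeat_cmd (r : nat) (c : cmd) : cmd :=
  Seq (Loop skip (Nonzero r) (Seq (Do (Dec r)) (Seq (Do (Inc 1)) c)))
      (Loop skip (Nonzero 1) (Seq (Do (Dec 1)) (Do (Inc r)))).

Definition is_bit (c : cell) : bool :=
  if c is Letter (Some _) then true else false.
Definition is_true_bit (c : cell) : bool :=
  if c is Letter (Some true) then true else false.

Definition skip_row : cmd := Seq (Loop skip (Cell is_bit) (Do (Inc 0))) (Do (Inc 0)).
(** Each row of an adjacency matrix starts with a bit, so a separator met at the start of a row can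
    only be the end of the graph. *)
Definition skip_graph : cmd := Seq (Loop skip (Cell is_bit) skip_row) (Do (Inc 0)).
Definition goto_graph (i : nat) : cmd := iter i (Seq ^~ skip_graph) (Do (Inc 0)).
Definition goto_row (i r : nat) : cmd := Seq (goto_graph i) (repeat_cmd r skip_row).

(** The number of vertices is never computed: the loop stops when the head, sent to row [r], finds
    the separator that ends the graph. *)
Definition for_vertex (i r : nat) (c : cmd) : cmd :=
  Seq (Loop (goto_row i r) (Cell is_bit) (Seq rewind (Seq c (Do (Inc r)))))
      (Seq rewind (clear r)).

Definition if_adj (i r r' : nat) (c d : cmd) : cmd :=
  Seq (Seq (goto_row i r) (repeat_cmd r' (Do (Inc 0))))
      (If (Cell is_true_bit) (Seq rewind c) (Seq rewind d)).

(* Computes the truncated difference of [r] and [r'] in register [2]. *)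
Definition if_le (r r' : nat) (c d : cmd) : cmd :=
  Seq (Seq (repeat_cmd r (Do (Inc 2)))
           (repeat_cmd r' (If (Nonzero 2) (Do (Dec 2)) skip)))
      (If (Nonzero 2) (Seq (clear 2) d) c).

Definition emit (r : nat) : cmd :=
  Seq (repeat_cmd r (Do (Out (Some true)))) (Do (Out None)).

(** * Correctness of the basic commands *)

Section Exec.
Variable w : seq symbol.
Let N := size w.

Lemma exec_do_eq a s s' o :
  node_ok w a s -> s' = node_next a s -> o = node_out a -> exec w (Do a) s s' o.
Proof. by move=> ok -> ->; apply: exec_do. Qed.

Lemma exec_skip s : exec w skip s s [::].
Proof. exact: exec_do_eq. Qed.

Lemma exec_seq_eq c d s s' s'' o1 o2 o :
  exec w c s s' o1 -> exec w d s' s'' o2 -> o = o1 ++ o2 ->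
  exec w (Seq c d) s s'' o.
Proof. by move=> ? ? ->; apply: exec_seq; eassumption. Qed.

Definition is_test (a : node) : bool :=
  match a with Nonzero _ | Cell _ => true | _ => false end.

Lemma exec_test a c d s s' o : is_test a ->
  exec w (if answer w a s then c else d) s s' o -> exec w (If a c d) s s' o.
Proof. by case: a => // x _ H; apply: exec_if. Qed.

Lemma exec_loopn c a d (S M : nat -> store) (O : nat -> seq symbol) n :
  is_test a ->
  (forall k, k <= n -> exec w c (S k) (M k) [::]) ->
  (forall k, k < n -> answer w a (M k)) -> answer w a (M n) = false ->
  (forall k, k < n -> exec w d (M k) (S k.+1) (O k)) ->
  exec w (Loop c a d) (S 0) (M n) (flatten [seq O k | k <- iota 0 n]).
Proof.
move=> ta.
have [ok nx no] : [/\ forall s, node_ok w a s, forall s, node_next a s = s & node_out a = [::]].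
  by case: a ta.
elim: n S M O => [|n IH] S M O Hc At Af Hd.
  by have := exec_stop d (Hc 0 isT) (ok _) Af; rewrite nx no.
have /= {}IH : exec w (Loop c a d) (S 1) (M n.+1)
    (flatten [seq O k.+1 | k <- iota 0 n]).
  by apply: (IH (S \o succn) (M \o succn) (O \o succn)) => // k kn;
    [apply: Hc|apply: At|apply: Hd].
rewrite /= (iotaDl 1 0) -map_comp.
have {}Hd := Hd 0 isT; rewrite -(nx (M 0)) in Hd.
by have := exec_loop (Hc 0 isT) (ok _) (At 0 isT) Hd IH; rewrite no.
Qed.

Lemma exec_while a d (S : nat -> store) (O : nat -> seq symbol) n :
  is_test a ->
  (forall k, k < n -> answer w a (S k)) -> answer w a (S n) = false ->
  (forall k, k < n -> exec w d (S k) (S k.+1) (O k)) ->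
  exec w (Loop skip a d) (S 0) (S n) (flatten [seq O k | k <- iota 0 n]).
Proof. by move=> ? ? ? ?; apply: exec_loopn => // *; apply: exec_skip. Qed.

Lemma exec_clear r s : exec w (clear r) s (upd r 0 s) [::].
Proof.
have := @exec_while (Nonzero r) (Do (Dec r)) (fun k => upd r (s r - k) s)
  (fun=> [::]) (s r).
rewrite flatten_nils subn0 upd_id subnn; apply => //= [k kx||k kx].
- by rewrite /upd eqxx; lia.
- by rewrite /upd eqxx.
apply: exec_do_eq => //=; first by rewrite /upd eqxx; lia.
store_eq.
Qed.

(** [B k] is the store after [k] rounds with the two counting registers put back to their outside
    values. The body really sees [x - k.+1] in [r] and [k.+1] in register 1, so it must not itself
    contain a repeat. *)
Lemma exec_repeat (r : nat) c x (B : nat -> store) (O : nat -> seq symbol) :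
  r != 1 -> x <= N -> (forall k, k <= x -> B k r = x /\ B k 1 = 0) ->
  (forall k, k < x -> exec w c (upd r (x - k.+1) (upd 1 k.+1 (B k)))
    (upd r (x - k.+1) (upd 1 k.+1 (B k.+1))) (O k)) ->
  exec w (repeat_cmd r c) (B 0) (B x) (flatten [seq O k | k <- iota 0 x]).
Proof.
move=> /eqP r1 xN HB Hc; have [Br B1] := HB x (leqnn _).
have r1' : (1 == r) = false by apply/eqP => /esym.
apply: (@exec_seq_eq _ _ _ (upd r 0 (upd 1 x (B x))) _
    (flatten [seq O k | k <- iota 0 x]) [::]); last by rewrite cats0.
  have := @exec_while (Nonzero r) (Seq (Do (Dec r)) (Seq (Do (Inc 1)) c))
    (fun k => upd r (x - k) (upd 1 k (B k))) O x.
  have -> : upd r (x - 0) (upd 1 0 (B 0)) = B 0.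
    have [e0 e1] := HB 0 isT; store_eq.
  rewrite subnn; apply => //= [k kx||k kx].
  - by rewrite /upd eqxx; lia.
  - by rewrite /upd eqxx.
  apply: (@exec_seq_eq _ _ _ (upd r (x - k.+1) (upd 1 k (B k))) _ [::]) => //.
    apply: exec_do_eq => //=; first by rewrite /upd eqxx; lia.
    store_eq.
  apply: (@exec_seq_eq _ _ _ _ _ [::] _ _ _ (Hc k kx)) => //.
  apply: exec_do_eq => //=.
    by rewrite /upd; case: eqP => [|_] /=; lia.
  store_eq.
have := @exec_while (Nonzero 1) (Seq (Do (Dec 1)) (Do (Inc r)))
    (fun k => upd r k (upd 1 (x - k) (B x))) (fun=> [::]) x.
rewrite flatten_nils subn0.
have -> : upd r x (upd 1 (x - x) (B x)) = B x by store_eq.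
apply => //= [k kx||k kx].
- by rewrite /upd r1' /=; lia.
- by rewrite B1.
apply: (@exec_seq_eq _ _ _ (upd r k (upd 1 (x - k.+1) (B x))) _ [::] [::]) => //.
  apply: exec_do_eq => //=; first by rewrite /upd r1' /=; lia.
  store_eq.
apply: exec_do_eq => //=; first by rewrite /upd eqxx; move: xN; rewrite /N; lia.
store_eq.
Qed.

Lemma exec_repeat0 (r : nat) c x s :
  r != 1 -> x <= N -> s r = x -> s 1 = 0 -> forall o : seq symbol,
  (forall k, k < x -> let s' := upd r (x - k.+1) (upd 1 k.+1 s) in exec w c s' s' o) ->
  exec w (repeat_cmd r c) s s (flatten (nseq x o)).
Proof.
move=> r1 xN sr s1 o H.
have -> : nseq x o = [seq o | _ <- iota 0 x].
  by rewrite -{1}(size_iota 0 x); elim: (iota 0 x) => //= a l ->.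
by apply: (@exec_repeat r c x (fun=> s) (fun=> o)).
Qed.

Lemma exec_emit r s :
  r != 1 -> s r <= N -> s 1 = 0 -> exec w (emit r) s s (encode_nat (s r)).
Proof.
move=> r1 rN s1.
apply: (@exec_seq_eq _ _ _ s _ (flatten (nseq (s r) [:: Some true])) [:: None]).
- by apply: exec_repeat0 => // k _ s'; apply: exec_do.
- exact: exec_do_eq.
by rewrite /encode_nat -cats1; congr cat; elim: (s r) => //= k <-.
Qed.

Lemma exec_if_le (r r' : nat) c d s s' o :
  2 < r -> 2 < r' -> s r <= N -> s r' <= N -> s 1 = 0 -> s 2 = 0 ->
  exec w (if s r <= s r' then c else d) s s' o ->
  exec w (if_le r r' c d) s s' o.
Proof.
move=> r2 r2' rN rN' s1 s2 H.
apply: (@exec_seq_eq _ _ _ (upd 2 (s r - s r') s) _ [::] o) => //.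
  apply: (@exec_seq_eq _ _ _ (upd 2 (s r) s) _ [::] [::]) => //.
    have := @exec_repeat r (Do (Inc 2)) (s r) (fun k => upd 2 k s) (fun=> [::]).
    rewrite flatten_nils; have -> : upd 2 0 s = s by store_eq.
    apply => //; first lia.
    - by move=> k _; rewrite /upd; split; case: eqP => //; lia.
    move=> k kr; apply: exec_do_eq => //=; first by rewrite /upd; repeat case: eqP; lia.
    store_eq.
  have := @exec_repeat r' (If (Nonzero 2) (Do (Dec 2)) skip) (s r')
    (fun k => upd 2 (s r - k) s) (fun=> [::]).
  rewrite flatten_nils subn0; apply => //; first lia.
  - by move=> k _; rewrite /upd; split; case: eqP => //; lia.
  move=> k kr; apply: exec_test => //=.
  have -> : upd r' (s r' - k.+1) (upd 1 k.+1 (upd 2 (s r - k) s)) 2 = s r - k.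
    by rewrite /upd; repeat case: eqP; lia.
  case: eqP => /= [e|/eqP e].
    have -> : s r - k.+1 = s r - k by lia.
    exact: exec_skip.
  apply: exec_do_eq => //=; first by rewrite /upd; repeat case: eqP; lia.
  store_eq.
apply: exec_test => //=; rewrite {1}/upd eqxx subn_eq0.
have e2 : upd 2 0 s = s by store_eq.
case: leqP H => [le|lt] H /=.
  by move/eqP: le => ->; rewrite e2.
apply: (@exec_seq_eq _ _ _ s _ [::] o) => //.
by have := exec_clear 2 (upd 2 (s r - s r') s); rewrite -[X in exec _ _ _ X _]/(upd _ _ _);
  have -> : upd 2 0 (upd 2 (s r - s r') s) = s by store_eq.
Qed.

(** * Moving through the encoded adjacency matrices *)

Variables (n : nat) (card : nat -> nat) (off : nat -> nat)
  (adj : nat -> nat -> nat -> bool).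
(* Row [x] of graph [i] starts at position [off i + x * (card i).+1] of [w]. *)
Let pos i x y := off i + x * (card i).+1 + y.
Hypothesis off0 : off 0 = 0.
Hypothesis offS : forall i, i < n -> off i.+1 = (pos i (card i) 0).+1.
Hypothesis pos_size : forall i, i < n -> pos i (card i) 0 < N.
Hypothesis nth_adj : forall i x y, i < n -> x < card i -> y < card i ->
  nth None w (pos i x y) = Some (adj i x y).
Hypothesis nth_row_end : forall i x, i < n -> x < card i ->
  nth None w (pos i x (card i)) = None.
Hypothesis nth_graph_end : forall i, i < n -> nth None w (pos i (card i) 0) = None.

Lemma read_bit p : is_bit (read_input w p.+1) = (nth None w p != None).
Proof.
have -> : read_input w p.+1 = if onth w p is Some a then Letter a else RightEnd by [].
by elim: w p => [|a l IH] [|p] //=; case: a.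
Qed.

Lemma read_true_bit p : is_true_bit (read_input w p.+1) = (nth None w p == Some true).
Proof.
have -> : read_input w p.+1 = if onth w p is Some a then Letter a else RightEnd by [].
by elim: w p => [|a l IH] [|p] //=; case: a => // -[].
Qed.

Lemma card_le i : i < n -> card i <= N.
Proof. by move/pos_size; rewrite /pos; nia. Qed.

Lemma exec_skip_row i x s :
  i < n -> x < card i -> s 0 = (pos i x 0).+1 ->
  exec w skip_row s (upd 0 (pos i x.+1 0).+1 s) [::].
Proof.
move=> lin xi s0; have ps := pos_size lin.
have le y : y <= card i -> pos i x y <= pos i (card i) 0 by rewrite /pos; nia.
apply: (@exec_seq_eq _ _ _ (upd 0 (pos i x (card i)).+1 s) _ [::] [::]) => //.
  have := @exec_while (Cell is_bit) (Do (Inc 0)) (fun k => upd 0 (pos i x k).+1 s)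
    (fun=> [::]) (card i).
  rewrite flatten_nils -s0 upd_id; apply => // [k kc||k kc].
  - by rewrite /answer /upd read_bit nth_adj.
  - by rewrite /answer /upd read_bit nth_row_end.
  apply: exec_do_eq => //=; first by rewrite /upd /=; have := le k (ltnW kc); lia.
  by rewrite /pos addnS; store_eq.
apply: exec_do_eq => //=; first by rewrite /upd /=; have := le _ (leqnn (card i)); lia.
have -> : pos i x.+1 0 = (pos i x (card i)).+1 by rewrite /pos; lia.
store_eq.
Qed.

Lemma exec_skip_graph i s :
  i < n -> s 0 = (off i).+1 -> exec w skip_graph s (upd 0 (off i.+1).+1 s) [::].
Proof.
move=> lin s0; have ps := pos_size lin.
apply: (@exec_seq_eq _ _ _ (upd 0 (pos i (card i) 0).+1 s) _ [::] [::]) => //.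
  have := @exec_while (Cell is_bit) skip_row (fun k => upd 0 (pos i k 0).+1 s)
    (fun=> [::]) (card i).
  have e0 : pos i 0 0 = off i by rewrite /pos; lia.
  rewrite flatten_nils e0 -s0 upd_id; apply => // [k kc||k kc].
  - by rewrite /answer /upd read_bit nth_adj //; lia.
  - by rewrite /answer /upd read_bit nth_graph_end.
  have := @exec_skip_row i k (upd 0 (pos i k 0).+1 s) lin kc erefl.
  by have -> : upd 0 (pos i k.+1 0).+1 (upd 0 (pos i k 0).+1 s) =
    upd 0 (pos i k.+1 0).+1 s by store_eq.
apply: exec_do_eq => //=; rewrite ?offS //; store_eq.
Qed.

Lemma exec_goto_graph i s :
  i < n -> s 0 = 0 -> exec w (goto_graph i) s (upd 0 (off i).+1 s) [::].
Proof.
move=> + s0; elim: i => [|i IH] lin /=.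
  by apply: exec_do_eq => //=; rewrite s0 ?off0.
apply: (@exec_seq_eq _ _ _ (upd 0 (off i).+1 s) _ [::] [::]) => //; first exact/IH/ltnW.
have := @exec_skip_graph i (upd 0 (off i).+1 s) (ltnW lin) erefl.
by have -> : upd 0 (off i.+1).+1 (upd 0 (off i).+1 s) = upd 0 (off i.+1).+1 s by store_eq.
Qed.

Lemma exec_goto_row (i r : nat) s :
  i < n -> 2 < r -> s r <= card i -> s 0 = 0 -> s 1 = 0 ->
  exec w (goto_row i r) s (upd 0 (pos i (s r) 0).+1 s) [::].
Proof.
move=> lin r2 ri s0 s1.
apply: (@exec_seq_eq _ _ _ (upd 0 (off i).+1 s) _ [::] [::]) => //.
  exact: exec_goto_graph.
have := @exec_repeat r skip_row (s r) (fun k => upd 0 (pos i k 0).+1 s) (fun=> [::]).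
have e0 : pos i 0 0 = off i by rewrite /pos; lia.
rewrite flatten_nils e0; apply; [lia|exact: leq_trans (card_le lin)| |] => k kr.
  by rewrite /upd; split; case: eqP => //; lia.
set s' := upd r _ _.
have s'0 : s' 0 = (pos i k 0).+1.
  by rewrite /s' /upd; have -> : (0 == r) = false by lia.
have := exec_skip_row lin (leq_trans kr ri) s'0.
have -> : upd 0 (pos i k.+1 0).+1 s' =
    upd r (s r - k.+1) (upd 1 k.+1 (upd 0 (pos i k.+1 0).+1 s)).
  rewrite /s'; store_eq.
by [].
Qed.

Lemma exec_rewind c s s' p o :
  s 0 = 0 -> exec w c s s' o -> exec w (Seq rewind c) (upd 0 p s) s' o.
Proof.
move=> s0 H; apply: (@exec_seq_eq _ _ _ s _ [::] o) => //.
have := exec_clear 0 (upd 0 p s).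
by have -> : upd 0 0 (upd 0 p s) = s by store_eq.
Qed.

Lemma exec_if_adj (i r r' : nat) c d s s' o :
  i < n -> 2 < r -> 2 < r' -> s r < card i -> s r' < card i ->
  s 0 = 0 -> s 1 = 0 ->
  exec w (if adj i (s r) (s r') then c else d) s s' o ->
  exec w (if_adj i r r' c d) s s' o.
Proof.
move=> lin r2 r2' ri ri' s0 s1 H.
have ps := pos_size lin.
apply: (@exec_seq_eq _ _ _ (upd 0 (pos i (s r) (s r')).+1 s) _ [::] o) => //.
  apply: (@exec_seq_eq _ _ _ (upd 0 (pos i (s r) 0).+1 s) _ [::] [::]) => //.
    by apply: exec_goto_row => //; apply: ltnW.
  have := @exec_repeat r' (Do (Inc 0)) (s r') (fun k => upd 0 (pos i (s r) k).+1 s) (fun=> [::]).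
  rewrite flatten_nils; apply; [lia|exact: leq_trans (ltnW ri') (card_le lin)| |] => k kr.
    by rewrite /upd; split; case: eqP => //; lia.
  have lt : pos i (s r) k < pos i (card i) 0 by rewrite /pos; nia.
  apply: exec_do_eq => //=; first by rewrite /upd; case: eqP => [|_] /=; lia.
  have -> : pos i (s r) k.+1 = (pos i (s r) k).+1 by rewrite /pos; lia.
  store_eq.
apply: exec_test => //; rewrite /answer {1}/upd eqxx read_true_bit nth_adj //.
rewrite (_ : (Some _ == Some true) = adj i (s r) (s r')); last by case: adj.
by move: H; case: adj => H; apply: exec_rewind.
Qed.

Lemma exec_for_vertex (i r : nat) c s (O : nat -> seq symbol) :
  i < n -> 2 < r -> s 0 = 0 -> s 1 = 0 -> s r = 0 ->
  (forall x, x < card i -> exec w c (upd r x s) (upd r x s) (O x)) ->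
  exec w (for_vertex i r c) s s (flatten [seq O x | x <- iota 0 (card i)]).
Proof.
move=> lin r2 s0 s1 sr H; have cN := card_le lin.
pose p x := (pos i x 0).+1.
have r0 : (0 == r) = false by lia.
apply: (@exec_seq_eq _ _ _ (upd 0 (p (card i)) (upd r (card i) s)) _
    (flatten [seq O x | x <- iota 0 (card i)]) [::]); last by rewrite cats0.
  have := @exec_loopn (goto_row i r) (Cell is_bit) (Seq rewind (Seq c (Do (Inc r))))
    (fun k => upd r k s) (fun k => upd 0 (p k) (upd r k s)) O (card i) isT.
  have -> : upd r 0 s = s by store_eq.
  apply => [k kc|k kc||k kc].
  - have er : upd r k s r = k by rewrite /upd eqxx.
    have e0 : upd r k s 0 = 0 by rewrite /upd r0.
    have e1 : upd r k s 1 = 0 by rewrite /upd; have -> : (1 == r) = false by lia.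
    by have := @exec_goto_row i r (upd r k s) lin r2; rewrite er e0 e1; apply.
  - by rewrite /answer {1}/upd eqxx /p read_bit nth_adj //; lia.
  - by rewrite /answer {1}/upd eqxx /p read_bit nth_graph_end.
  apply: exec_rewind; first by rewrite /upd r0.
  apply: (@exec_seq_eq _ _ _ (upd r k s) _ (O k) [::]); last by rewrite cats0.
    exact: H.
  apply: exec_do_eq => //=; first by rewrite /upd eqxx; lia.
  store_eq.
apply: exec_rewind; first by rewrite /upd r0.
have := exec_clear r (upd r (card i) s).
by have -> : upd r 0 (upd r (card i) s) = s by store_eq.
Qed.

(** * Loops over tuples of vertices and decision trees *)

Definition env (v : seq nat) : store := fun r => nth 0 [:: 0, 0, 0 & v] r.

Lemma env_rcons v x : upd (size v).+3 x (env v) = env (rcons v x).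
Proof.
apply/funext => -[|[|[|r]]] //; rewrite /upd /env /= nth_rcons !eqSS.
by case: ltngtP => // h; rewrite nth_default // ltnW.
Qed.

Fixpoint tuples (ss : seq nat) : seq (seq nat) :=
  if ss is i :: ss' then [seq x :: u | x <- iota 0 (card i), u <- tuples ss']
  else [:: [::]].

Definition in_range (v ss : seq nat) : bool := all2 (fun x i => x < card i) v ss.

Lemma mem_tuples ss u : (u \in tuples ss) = in_range u ss.
Proof.
elim: ss u => [|i ss IH] [|x u] //=; first by apply/allpairsP => -[[y z] /= [_ _]].
apply/allpairsP/andP => [[[y z] /= [yi zt [-> ->]]]|[xi us]].
  by rewrite mem_iota /= in yi; rewrite yi -IH.
by exists (x, u); rewrite mem_iota IH /=; split.
Qed.

Lemma tuples_uniq ss : uniq (tuples ss).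
Proof.
elim: ss => //= i ss IH; apply: allpairs_uniq => //; first exact: iota_uniq.
by move=> [x u] [y v] _ _ /= [-> ->].
Qed.

Lemma in_range_size v ss : in_range v ss -> size v = size ss.
Proof. by rewrite /in_range all2E => /andP [/eqP]. Qed.

Lemma in_range_nth v ss k :
  in_range v ss -> k < size ss -> nth 0 v k < card (nth 0 ss k).
Proof.
by elim: v ss k => [|x v IH] [|i ss] [|k] //= /andP [xi h] // ks; apply: IH.
Qed.

Lemma in_range_cat v u ss ts :
  in_range v ss -> in_range u ts -> in_range (v ++ u) (ss ++ ts).
Proof.
elim: v ss => [|x v IH] [|i ss] //= /andP [-> h] hu; exact: IH.
Qed.

Fixpoint for_tuple (ss : seq nat) (r : nat) (c : cmd) : cmd :=
  if ss is i :: ss' then for_vertex i r (for_tuple ss' r.+1 c) else c.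

Lemma exec_for_tuple ss v c (O : seq nat -> seq symbol) :
  all (fun i => i < n) ss ->
  (forall u, u \in tuples ss -> exec w c (env (v ++ u)) (env (v ++ u)) (O u)) ->
  exec w (for_tuple ss (size v).+3 c) (env v) (env v)
    (flatten [seq O u | u <- tuples ss]).
Proof.
elim: ss v O => [|i ss IH] v O /= => [_ H|/andP [lin al] H].
  by have := H [::] isT; rewrite cats0 cats0.
have -> : flatten [seq O u | u <- [seq x :: u | x <- iota 0 (card i), u <- tuples ss]] =
    flatten [seq flatten [seq O (x :: u) | u <- tuples ss] | x <- iota 0 (card i)].
  elim: (iota 0 (card i)) => //= x l IHl.
  by rewrite map_cat flatten_cat IHl -map_comp.
apply: exec_for_vertex => //; first by rewrite /env /= nth_default.
move=> x xi; rewrite env_rcons.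
have := IH (rcons v x) (fun u => O (x :: u)) al; rewrite size_rcons; apply => u us.
rewrite cat_rcons; apply: H; apply/allpairsP; exists (x, u); rewrite mem_iota.
by split.
Qed.

(* Register [k.+3] holds the [k]-th variable, ranging over the vertices of the
   graph [nth 0 ss k]. *)
Fixpoint ask (ss : seq nat) (qs : seq (nat * nat))
    (kont : seq (bool * bool) -> cmd) : cmd :=
  if qs is (k, l) :: qs' then
    let c b b' := ask ss qs' (fun a => kont ((b, b') :: a)) in
    let d b := if_adj (nth 0 ss k) k.+3 l.+3 (c b true) (c b false) in
    if_le k.+3 l.+3 (d true) (d false)
  else kont [::].

(** Only vertices of the same graph can be compared. Both orders of a pair occur, so two [<=]
    answers decide equality. *)
Definition queries (ss : seq nat) : seq (nat * nat) :=
  [seq q <- [seq (k, l) | k <- iota 0 (size ss), l <- iota 0 (size ss)]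
     | nth 0 ss q.1 == nth 0 ss q.2].

Definition answers (ss : seq nat) (qs : seq (nat * nat)) (v : seq nat) :=
  [seq (nth 0 v q.1 <= nth 0 v q.2,
        adj (nth 0 ss q.1) (nth 0 v q.1) (nth 0 v q.2)) | q <- qs].

Definition pattern (ss v : seq nat) := answers ss (queries ss) v.

Lemma mem_queries ss k l : ((k, l) \in queries ss) =
  [&& k < size ss, l < size ss & nth 0 ss k == nth 0 ss l].
Proof.
rewrite mem_filter /= andbA [RHS]andbC; congr andb.
apply/allpairsP/andP => [[[x y] /=]|[kl lk]].
  by rewrite !mem_iota /= => -[? ? [-> ->]].
by exists (k, l); rewrite !mem_iota.
Qed.

(** The tree is unfolded when the command is built: every leaf applies [kont] to a constant list of
    answers. Hence any function of the answers, even one defined classically, becomes a finite piece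
    of program. *)
Lemma exec_ask ss qs kont v s' o :
  all (fun i => i < n) ss -> in_range v ss -> {subset qs <= queries ss} ->
  exec w (kont (answers ss qs v)) (env v) s' o ->
  exec w (ask ss qs kont) (env v) s' o.
Proof.
move=> al vr; elim: qs kont => [|[k l] qs IH] kont //= sub H.
have [ks ls /eqP kl] : [/\ k < size ss, l < size ss & nth 0 ss k == nth 0 ss l].
  by apply/and3P; rewrite -mem_queries; apply: sub; rewrite mem_head.
have lin : nth 0 ss k < n by apply: (allP al); apply: mem_nth.
have vk := in_range_nth vr ks; have vl := in_range_nth vr ls; rewrite -kl in vl.
have cN := card_le lin.
have {}IH kont' : exec w (kont' (answers ss qs v)) (env v) s' o ->
    exec w (ask ss qs kont') (env v) s' o.
  by apply: IH => q qq; apply: sub; rewrite in_cons qq orbT.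
apply: exec_if_le => //; try by apply: leq_trans cN; apply: ltnW.
move: H; rewrite -[env v k.+3]/(nth 0 v k) -[env v l.+3]/(nth 0 v l).
case: (nth 0 v k <= nth 0 v l) => H; apply: exec_if_adj => //;
  move: H; rewrite -[env v k.+3]/(nth 0 v k) -[env v l.+3]/(nth 0 v l);
  by case: adj => H; apply: IH.
Qed.

Definition outs (l : seq symbol) : cmd := foldr (fun x => Seq (Do (Out x))) skip l.

Lemma exec_outs l s : exec w (outs l) s s l.
Proof.
elim: l => [|x l IH] /=; first exact: exec_skip.
by apply: (@exec_seq_eq _ _ _ s _ [:: x] l) => //; apply: exec_do.
Qed.

Variables (js : seq nat) (S : nat -> seq nat).
Hypothesis S_sorts : forall j, j \in js -> all (fun i => i < n) (S j).

Definition candidates : seq (nat * seq nat) :=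
  [seq (j, u) | j <- js, u <- tuples (S j)].

Definition for_points (r : nat) (c : nat -> cmd) : cmd :=
  foldr (fun j d => Seq (for_tuple (S j) r (c j)) d) skip js.

Lemma exec_for_points v c (O : nat * seq nat -> seq symbol) :
  (forall j u, j \in js -> in_range u (S j) ->
    exec w (c j) (env (v ++ u)) (env (v ++ u)) (O (j, u))) ->
  exec w (for_points (size v).+3 c) (env v) (env v)
    (flatten [seq O p | p <- candidates]).
Proof.
rewrite /for_points /candidates; elim: js S_sorts => [|j l IH] al H /=.
  exact: exec_skip.
rewrite map_cat flatten_cat -map_comp.
apply: exec_seq; last first.
  by apply: IH => [i il|i u il]; [apply: al|apply: H]; rewrite in_cons il orbT.
apply: exec_for_tuple; first by apply: al; rewrite mem_head.
by move=> u; rewrite mem_tuples => us; apply: H => //; rewrite mem_head.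
Qed.

Variable good : nat -> seq (bool * bool) -> bool.

Definition selected : seq (nat * seq nat) :=
  [seq p <- candidates | good p.1 (pattern (S p.1) p.2)].

Definition for_selected (c : nat -> cmd) : cmd :=
  for_points 3 (fun j =>
    ask (S j) (queries (S j)) (fun a => if good j a then c j else skip)).

Lemma exec_for_selected c (O : nat * seq nat -> seq symbol) :
  (forall j u, j \in js -> in_range u (S j) -> good j (pattern (S j) u) ->
    exec w (c j) (env u) (env u) (O (j, u))) ->
  exec w (for_selected c) (fun=> 0) (fun=> 0) (flatten [seq O p | p <- selected]).
Proof.
move=> H; have -> : (fun=> 0) = env [::].
  by apply/funext => -[|[|[|r]]] //; rewrite /env /= nth_nil.
have -> : flatten [seq O p | p <- selected] =
    flatten [seq if good p.1 (pattern (S p.1) p.2) then O p else [::] | p <- candidates].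
  rewrite /selected; elim: candidates => //= p l IH.
  by case: ifP => /= _; rewrite IH.
apply: (@exec_for_points [::] _ (fun p => if good p.1 (pattern (S p.1) p.2) then O p else [::])).
move=> j u jj us; apply: exec_ask => //; first exact: S_sorts.
rewrite -/(pattern (S j) u) /=.
by case: ifP => [g|_]; [apply: H|apply: exec_skip].
Qed.

Definition emit_tuple (m : nat) : cmd :=
  foldr (fun k => Seq (emit k.+3)) skip (iota 0 m).

Lemma exec_emit_tuple u ss : all (fun i => i < n) ss -> in_range u ss ->
  exec w (emit_tuple (size ss)) (env u) (env u) (flatten [seq encode_nat x | x <- u]).
Proof.
move=> al us.
have uN k : k < size ss -> nth 0 u k <= N.
  move=> ks; apply: leq_trans (card_le (allP al _ (mem_nth 0 ks))).
  by apply: ltnW; apply: in_range_nth.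
have -> : [seq encode_nat x | x <- u] =
    [seq encode_nat (nth 0 u k) | k <- iota 0 (size ss)].
  by rewrite -{1}(mkseq_nth 0 u) /mkseq -map_comp (in_range_size us).
rewrite /emit_tuple.
have {uN} : {in iota 0 (size ss), forall k, nth 0 u k <= N}.
  by move=> k; rewrite mem_iota => /uN.
elim: (iota 0 (size ss)) => [|k l IH] uN /=; first exact: exec_skip.
apply: exec_seq; last by apply: IH => i il; apply: uN; rewrite in_cons il orbT.
by apply: (@exec_emit k.+3) => //; apply: uN; rewrite mem_head.
Qed.

Definition mark_cmd (B : nat -> seq symbol) : cmd := for_selected (fun j => outs (B j)).

Lemma exec_mark B :
  exec w (mark_cmd B) (fun=> 0) (fun=> 0) (flatten [seq B p.1 | p <- selected]).
Proof.
by apply: (@exec_for_selected _ (fun p => B p.1)) => j u _ _ _; apply: exec_outs.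
Qed.

Definition list_cmd : cmd :=
  for_selected (fun j => Seq (outs (encode_nat j)) (emit_tuple (size (S j)))).

Lemma exec_list :
  exec w list_cmd (fun=> 0) (fun=> 0)
    (flatten [seq encode_nat p.1 ++ flatten [seq encode_nat x | x <- p.2] | p <- selected]).
Proof.
apply: (@exec_for_selected _ (fun p => encode_nat p.1 ++ flatten [seq encode_nat x | x <- p.2])).
move=> j u jj us _ /=; apply: exec_seq; first exact: exec_outs.
by apply: exec_emit_tuple => //; apply: S_sorts.
Qed.

(** The inner loop visits all candidates without selecting: the joint pattern of both tuples reveals
    whether the second one codes a point, and [D] can output nothing when it does not. *)
Definition matrix_cmd (D : nat -> nat -> seq (bool * bool) -> seq symbol) : cmd :=
  Seq (for_selected (fun j =>
         Seq (for_points (size (S j)).+3 (fun l =>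
                ask (S j ++ S l) (queries (S j ++ S l)) (fun a => outs (D j l a))))
             (outs [:: None])))
      (outs [:: None]).

Lemma exec_matrix D :
  exec w (matrix_cmd D) (fun=> 0) (fun=> 0)
    (rcons (flatten [seq rcons (flatten
       [seq D p.1 q.1 (pattern (S p.1 ++ S q.1) (p.2 ++ q.2)) | q <- candidates]) None
       | p <- selected]) None).
Proof.
rewrite -cats1; apply: exec_seq; last exact: exec_outs.
apply: (@exec_for_selected _ (fun p => rcons (flatten
  [seq D p.1 q.1 (pattern (S p.1 ++ S q.1) (p.2 ++ q.2)) | q <- candidates]) None)).
move=> j u jj us _; rewrite -cats1; apply: exec_seq; last exact: exec_outs.
rewrite -(in_range_size us).
apply: (@exec_for_points u _ (fun q => D j q.1 (pattern (S j ++ S q.1) (u ++ q.2)))).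
move=> l t ll ts; apply: exec_ask => //.
- by rewrite all_cat !S_sorts.
- exact: in_range_cat.
exact: exec_outs.
Qed.
End Exec.

Lemma nth_flatten_at (T : Type) (x0 : T) (ss : seq (seq T)) i p :
  p < size (nth [::] ss i) ->
  nth x0 (flatten ss) (sumn (take i (shape ss)) + p) = nth x0 (nth [::] ss i) p.
Proof.
elim: ss i => [|s ss IH] [|i] //= h; first by rewrite add0n nth_cat h.
by rewrite -addnA nth_cat ltnNge leq_addr /= addKn IH.
Qed.

(** * Addresses of the bits and separators of an encoded input *)

Definition gcard n (X : 'I_n -> fincoh) (i : nat) : nat :=
  if insub i is Some i' then fcard (X i') else 0.

Definition gadj n (X : 'I_n -> fincoh) (i x y : nat) : bool :=
  if insub i is Some i' then
    match insub x, insub y with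
    | Some a, Some b => @fadj (X i') a b
    | _, _ => false
    end
  else false.

Lemma gcardE n (X : 'I_n -> fincoh) (i : 'I_n) : gcard X i = fcard (X i).
Proof. by rewrite /gcard valK. Qed.

Lemma gadjE n (X : 'I_n -> fincoh) (i : 'I_n) (x y : 'I_(fcard (X i))) :
  gadj X i x y = fadj x y.
Proof. by rewrite /gadj !valK. Qed.

Section Layout.
Variables (n : nat) (X : 'I_n -> fincoh).

Let graphs := [seq encode_graph (@fadj (X i)) | i <- enum 'I_n].

Definition goff (i : nat) : nat := sumn (take i (shape graphs)).

(** The final separator counts as one more row, so that [nth_flatten_at] locates it like the
    others. *)
Let rows (i : 'I_n) :=
  rcons [seq rcons [seq Some (fadj x y) | y <- enum 'I_(fcard (X i))] None
        | x <- enum 'I_(fcard (X i))] [:: None].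

Let encode_graph_rows i : encode_graph (@fadj (X i)) = flatten (rows i).
Proof. by rewrite /rows flatten_rcons cats1. Qed.

Let shape_rows i : shape (rows i) = rcons (nseq (fcard (X i)) (fcard (X i)).+1) 1.
Proof.
rewrite /shape /rows map_rcons -map_comp; congr rcons.
transitivity [seq (fcard (X i)).+1 | _ <- enum 'I_(fcard (X i))].
  by apply: eq_map => x /=; rewrite size_rcons size_map size_enum_ord.
transitivity (nseq (size (enum 'I_(fcard (X i)))) (fcard (X i)).+1).
  by elim: (enum _) => //= x l ->.
by rewrite size_enum_ord.
Qed.

Let size_graph i : size (encode_graph (@fadj (X i))) = (fcard (X i) * (fcard (X i)).+1).+1.
Proof.
by rewrite encode_graph_rows size_flatten shape_rows sumn_rcons sumn_nseq mulnC addn1.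
Qed.

Let nth_graphs (i : 'I_n) : nth [::] graphs i = encode_graph (@fadj (X i)).
Proof. by rewrite (nth_map i) ?size_enum_ord // nth_ord_enum. Qed.

Let nth_input (i : 'I_n) p : p <= fcard (X i) * (fcard (X i)).+1 ->
  nth None (encode_input X) (goff i + p) = nth None (encode_graph (@fadj (X i))) p.
Proof. by move=> h; rewrite nth_flatten_at nth_graphs // size_graph ltnS. Qed.

Let nth_row (i : 'I_n) x p : x <= fcard (X i) -> p < size (nth [::] (rows i) x) ->
  nth None (encode_graph (@fadj (X i))) (x * (fcard (X i)).+1 + p) =
  nth None (nth [::] (rows i) x) p.
Proof.
move=> xi h; rewrite encode_graph_rows -nth_flatten_at //; congr nth; congr addn.
by rewrite shape_rows -cats1 takel_cat ?size_nseq // take_nseq // sumn_nseq mulnC.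
Qed.

Lemma goff0 : goff 0 = 0. Proof. by rewrite /goff take0. Qed.

Lemma goffS i : i < n -> goff i.+1 = (goff i + gcard X i * (gcard X i).+1 + 0).+1.
Proof.
move=> lin; pose i' := Ordinal lin; rewrite -[i]/(val i') gcardE addn0.
have h : i < size (shape graphs) by rewrite /shape /graphs 2!size_map size_enum_ord.
have gi : size (nth [::] graphs i) = (fcard (X i') * (fcard (X i')).+1).+1.
  by rewrite -[i]/(val i') nth_graphs size_graph.
rewrite /goff (take_nth 0 h) sumn_rcons (nth_map [::]) ?gi ?addnS //.
by rewrite /graphs size_map size_enum_ord.
Qed.

Lemma goff_size i :
  i < n -> goff i + gcard X i * (gcard X i).+1 + 0 < size (encode_input X).
Proof.
move=> lin; rewrite -goffS // size_flatten /goff.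
by rewrite -{2}(cat_take_drop i.+1 (shape graphs)) sumn_cat leq_addr.
Qed.

Let row (i : 'I_n) x := rcons [seq Some (fadj x y) | y <- enum 'I_(fcard (X i))] None.

Let size_row i x : size (@row i x) = (fcard (X i)).+1.
Proof. by rewrite size_rcons size_map size_enum_ord. Qed.

Let nth_rows (i : 'I_n) x (xi : x < fcard (X i)) :
  nth [::] (rows i) x = row (Ordinal xi).
Proof.
rewrite nth_rcons size_map size_enum_ord xi (nth_map (Ordinal xi)) ?size_enum_ord //.
by rewrite -[x]/(val (Ordinal xi)) nth_ord_enum.
Qed.

Lemma nth_input_adj i x y : i < n -> x < gcard X i -> y < gcard X i ->
  nth None (encode_input X) (goff i + x * (gcard X i).+1 + y) = Some (gadj X i x y).
Proof.
move=> lin; pose i' := Ordinal lin; rewrite -[i]/(val i') gcardE => xi yi.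
rewrite -addnA nth_input; last nia.
rewrite nth_row ?(ltnW xi) // nth_rows ?size_row ?ltnS ?(ltnW yi) //.
rewrite nth_rcons size_map size_enum_ord yi (nth_map (Ordinal xi)) ?size_enum_ord //.
rewrite -[y]/(val (Ordinal yi)) nth_ord_enum -[x]/(val (Ordinal xi)).
by rewrite (@gadjE _ X i').
Qed.

Lemma nth_input_row_end i x : i < n -> x < gcard X i ->
  nth None (encode_input X) (goff i + x * (gcard X i).+1 + gcard X i) = None.
Proof.
move=> lin; pose i' := Ordinal lin; rewrite -[i]/(val i') gcardE => xi.
rewrite -addnA nth_input; last nia.
rewrite nth_row ?(ltnW xi) // nth_rows ?size_row //.
by rewrite nth_rcons size_map size_enum_ord ltnn eqxx.
Qed.

Lemma nth_input_graph_end i : i < n ->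
  nth None (encode_input X) (goff i + gcard X i * (gcard X i).+1 + 0) = None.
Proof.
move=> lin; pose i' := Ordinal lin; rewrite -[i]/(val i') gcardE.
rewrite -addnA nth_input; last by rewrite addn0.
have nx : nth [::] (rows i') (fcard (X i')) = [:: None].
  by rewrite nth_rcons size_map size_enum_ord ltnn eqxx.
by rewrite nth_row ?nx.
Qed.
End Layout.

Section Programs.
Variables (n : nat) (js : seq nat) (S : nat -> seq nat)
  (good : nat -> seq (bool * bool) -> bool).
Hypothesis S_sorts : forall j, j \in js -> all (fun i => i < n) (S j).

Definition gselected (X : 'I_n -> fincoh) := selected (gcard X) (gadj X) js S good.

Lemma logspace_mark (B : nat -> seq symbol) :
  logspace_computable (@encode_input n)
    (fun X => flatten [seq B p.1 | p <- gselected X]).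
Proof.
apply: (@exec_logspace _ _ _ (mark_cmd js S good B)) => X; exists (fun=> 0).
exact: (exec_mark (@goff0 n X) (@goffS n X) (@goff_size n X) (@nth_input_adj n X)
  (@nth_input_row_end n X) (@nth_input_graph_end n X) S_sorts _).
Qed.

Lemma logspace_matrix_list (D : nat -> nat -> seq (bool * bool) -> seq symbol) :
  logspace_computable (@encode_input n)
    (fun X => rcons (flatten [seq rcons (flatten
       [seq D p.1 q.1 (pattern (gadj X) (S p.1 ++ S q.1) (p.2 ++ q.2))
       | q <- candidates (gcard X) js S]) None | p <- gselected X]) None ++
     flatten [seq encode_nat p.1 ++ flatten [seq encode_nat x | x <- p.2]
             | p <- gselected X]).
Proof.
apply: (@exec_logspace _ _ _ (Seq (matrix_cmd js S good D) (list_cmd js S good))) => X.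
exists (fun=> 0); apply: exec_seq.
  exact: (exec_matrix (@goff0 n X) (@goffS n X) (@goff_size n X) (@nth_input_adj n X)
    (@nth_input_row_end n X) (@nth_input_graph_end n X) S_sorts _).
exact: (exec_list (@goff0 n X) (@goffS n X) (@goff_size n X) (@nth_input_adj n X)
  (@nth_input_row_end n X) (@nth_input_graph_end n X) S_sorts).
Qed.
End Programs.

(** * Normal forms *)

Lemma power_ext n (X Y : CohI^n) (f g : hom X Y) :
  (forall i, (f i : emb _ _) =1 g i) -> f = g.
Proof. by move=> H; apply: functional_extensionality_dep => i; apply: emb_eq. Qed.

Lemma surj_iso n (X Y : CohI^n) (f : hom X Y) :
  (forall i y, exists x, (f i : emb _ _) x = y) -> is_iso f.
Proof.
move=> fs.
have G i : {g : emb (Y i) (X i) | forall y, (f i : emb _ _) (g y) = y}.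
  apply: cid; have [g gP] := choice (fs i).
  have gi : injective g by move=> x y E; rewrite -(gP x) E gP.
  have gc x y : cohr (g x) (g y) <-> cohr x y.
    by rewrite -(emb_coh (f i : emb _ _)) !gP.
  by exists (Emb gi gc).
exists (fun i => sval (G i)); split; apply: power_ext => i x /=.
  by apply: (@emb_inj _ _ (f i : emb _ _)); rewrite (svalP (G i)).
by rewrite (svalP (G i)).
Qed.

Lemma farr_cmp n (F : functor CohI^n CohI) (X Y Z : CohI^n) (g : hom Y Z)
    (f : hom X Y) x :
  (farr F (cmp g f) : emb _ _) x = (farr F g : emb _ _) ((farr F f : emb _ _) x).
Proof. by rewrite farrM. Qed.

Section FiberProduct.
Variables (A B D : coh) (f : emb A D) (g : emb B D).

(** Coherence of the first components is also that of the second ones, as [f] and [g] both reflect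
    it from [D]. *)
Definition fiber_product : coh :=
  @Coh {p : A * B | f p.1 = g p.2} (fun p q => cohr (sval p).1 (sval q).1)
    (fun p => cohr_refl _) (fun p q => @cohr_sym _ _ _).

Definition fiber_fst : emb fiber_product A.
Proof.
apply: (@Emb fiber_product A (fun p => (sval p).1)) => //.
move=> [[a b] /= e] [[a' b'] /= e'] /= E; apply: eq_exist; congr pair => //.
by apply: (@emb_inj _ _ g); rewrite -e -e' E.
Defined.

Definition fiber_snd : emb fiber_product B.
Proof.
apply: (@Emb fiber_product B (fun p => (sval p).2)).
  move=> [[a b] /= e] [[a' b'] /= e'] /= E; apply: eq_exist; congr pair => //.
  by apply: (@emb_inj _ _ f); rewrite e e' E.
by move=> [[a b] /= e] [[a' b'] /= e']; rewrite -(emb_coh g) -(emb_coh f) e e'.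
Defined.

Lemma fiber_productP : pullback_on_web f g fiber_fst fiber_snd.
Proof.
split=> [[p e] //|a b e].
by exists (exist (fun p : A * B => f p.1 = g p.2) (a, b) e).
Qed.
End FiberProduct.

Section NormalForms.
Variables (n : nat) (F : normal_functor n).

Let Fp : web_pullbacks F. Proof. exact/web_pullbacksP/nfun_pullback. Qed.

(** As [F] preserves the pullback of [f] and [g], the common point comes from a point over their
    fibre product. Minimality of both normal forms makes the two projections isomorphisms, and [t]
    is the second one after the inverse of the first. *)
Lemma nform_unique (a b : nform F) (X : CohI^n)
    (f : hom (coh_of_fins (nf_sp a)) X) (g : hom (coh_of_fins (nf_sp b)) X) :
  (farr F f : emb _ _) (nf_pt a) = (farr F g : emb _ _) (nf_pt b) ->
  exists t : hom (coh_of_fins (nf_sp a)) (coh_of_fins (nf_sp b)),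
    [/\ is_iso t, f = cmp g t & (farr F t : emb _ _) (nf_pt a) = nf_pt b].
Proof.
move=> E; pose P : CohI^n := fun i => fiber_product (f i) (g i).
pose p : hom P (coh_of_fins (nf_sp a)) := fun i => fiber_fst (f i) (g i).
pose q : hom P (coh_of_fins (nf_sp b)) := fun i => fiber_snd (f i) (g i).
have [w [wa wb]] := @Fp _ _ _ P f g p q (fun i => fiber_productP (f i) (g i)) _ _ E.
have [p' [p'p pp']] := nf_min wa; have [q' [q'q qq']] := nf_min wb.
have fg : cmp f p = cmp g q.
  by apply: power_ext => i x; apply: (fiber_productP (f i) (g i)).1.
exists (cmp q p'); split.
- exists (cmp p q'); split.
    by rewrite cmpA -(cmpA p q' q) q'q cmpf1 pp'.
  by rewrite cmpA -(cmpA q p' p) p'p cmpf1 qq'.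
- by rewrite cmpA -fg -cmpA pp' cmpf1.
by rewrite farr_cmp -wa -(@farr_cmp _ F _ _ _ p' p) p'p farr1.
Qed.

Definition sub_fin (Y : fincoh) (D : {set 'I_(fcard Y)}) : fincoh :=
  @FinCoh #|D| (fun x y => fadj (enum_val x) (enum_val y))
    (fun x => fadj_refl _) (fun x y => fadj_sym _ _).

Definition sub_fin_emb (Y : fincoh) (D : {set 'I_(fcard Y)}) :
  emb (coh_of_fin (sub_fin D)) (coh_of_fin Y).
Proof.
apply: (@Emb (coh_of_fin (sub_fin D)) (coh_of_fin Y) (fun x : 'I_#|D| => enum_val x)) => //.
exact: enum_val_inj.
Defined.

(** Induction on the number of vertices: a point that is not minimal already comes from a proper
    subspace. *)
Lemma nform_exists (Y : 'I_n -> fincoh) (y : web (F (coh_of_fins Y))) :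
  exists (a : nform F) (f : hom (coh_of_fins (nf_sp a)) (coh_of_fins Y)),
    (farr F f : emb _ _) (nf_pt a) = y.
Proof.
have [m] := ubnP (\sum_(i < n) fcard (Y i)); elim: m Y y => // m IH Y y.
rewrite ltnS => Ym.
have [ymin|] := pselect (forall (Z : CohI^n) (k : hom Z (coh_of_fins Y)) (z : web (F Z)),
    (farr F k : emb _ _) z = y -> is_iso k).
  by exists (NForm ymin), (idm _); rewrite farr1.
move=> /existsNP [Z] /existsNP [k] /existsNP [z] /not_implyP [kz nk].
(* [Z] is an arbitrary coherence space; it is replaced by the image of [k], renumbered as a member
   of the skeleton. *)
pose D i : {set 'I_(fcard (Y i))} := [set x | `[< exists u, (k i : emb _ _) u = x >]].
pose Y' i := sub_fin (D i).
pose e : hom (coh_of_fins Y') (coh_of_fins Y) := fun i => sub_fin_emb (D i).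
have L i : {h : emb (Z i) (coh_of_fin (Y' i)) | forall u, sub_fin_emb (D i) (h u) = (k i : emb _ _) u}.
  apply: cid.
  have /choice [h hP] : forall u : Z i, exists v : coh_of_fin (Y' i),
      sub_fin_emb (D i) v = (k i : emb _ _) u.
    move=> u; have uD : ((k i : emb _ _) u : 'I_(fcard (Y i))) \in D i.
      by rewrite inE; apply/asboolP; exists u.
    by exists (enum_rank_in uD ((k i : emb _ _) u)); rewrite /= enum_rankK_in.
  have hi : injective h.
    by move=> u v E; apply: (@emb_inj _ _ (k i : emb _ _)); rewrite -!hP E.
  have hc u v : cohr (h u) (h v) <-> cohr u v.
    by rewrite -(emb_coh (sub_fin_emb (D i))) !hP emb_coh.
  by exists (Emb hi hc).
pose h : hom Z (coh_of_fins Y') := fun i => sval (L i).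
have eh : cmp e h = k by apply: power_ext => i u; apply: (svalP (L i)).
have lt : \sum_(i < n) fcard (Y' i) < m.
  apply: leq_trans Ym; rewrite ltn_neqAle; apply/andP; split; last first.
    by apply: leq_sum => i _; rewrite -[leqRHS]card_ord; apply: max_card.
  (* Equal totals force equality in each component, so every [D i] would be the whole space and [k]
     an isomorphism. *)
  apply/eqP => E; apply: nk; apply: surj_iso => i x.
  have Ei : fcard (Y' i) = fcard (Y i).
    apply/eqP; rewrite eqn_leq; apply/andP; split.
      by rewrite -[leqRHS]card_ord; apply: max_card.
    rewrite leqNgt; apply/negP => lti.
    move/eqP: E; apply/negP; rewrite neq_ltn; apply/orP; left.
    rewrite (bigD1 i) //= [ltnRHS](bigD1 i) //= -addSn leq_add //.
    by apply: leq_sum => l _; rewrite -[leqRHS]card_ord; apply: max_card.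
  have : x \in D i.
    suff -> : D i = [set: 'I_(fcard (Y i))] by rewrite inE.
    by apply/eqP; rewrite eqEcard finset.subsetT cardsT card_ord -[X in X <= _]Ei leqnn.
  by rewrite inE => /asboolP.
have [a [f fa]] := IH Y' ((farr F h : emb _ _) z) lt.
by exists a, (cmp e f); rewrite farr_cmp fa -farr_cmp eh.
Qed.

(** The adjacency table of [Y], padded with [false]; it serves as the name of the component of
    [universal_coh] into which [Y] embeds. *)
Definition tagged_adj (d : nat) (Y : fincoh) : {ffun 'I_d * 'I_d -> bool} :=
  [ffun p => if (insub (val p.1), insub (val p.2)) is (Some x, Some y)
             then @fadj Y x y else false].

(* The disjoint union, over all relations on [d] points, of their symmetric
   parts made reflexive: every coherence space with at most [d] points embeds. *)
Definition universal_coh (d : nat) : fincoh.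
Proof.
pose T : finType := ({ffun 'I_d * 'I_d -> bool} * 'I_d)%type.
pose r (x y : T) := (x == y) || [&& x.1 == y.1, x.1 (x.2, y.2) & x.1 (y.2, x.2)].
apply: (@FinCoh #|T| (fun x y => r (enum_val x) (enum_val y))).
  by move=> x; rewrite /r eqxx.
move=> x y; rewrite /r eq_sym; congr orb.
by rewrite [(enum_val y).1 == _]eq_sym; case: eqP => //= ->; rewrite andbC.
Defined.

Lemma universal_emb (d : nat) (Y : fincoh) : fcard Y <= d ->
  exists e : emb (coh_of_fin Y) (coh_of_fin (universal_coh d)), True.
Proof.
move=> Yd.
pose f (x : 'I_(fcard Y)) : 'I_(fcard (universal_coh d)) :=
  enum_rank (tagged_adj d Y, widen_ord Yd x).
have fi : injective f by move=> x y /enum_rank_inj [] /val_inj.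
have fc x y : @fadj (universal_coh d) (f x) (f y) <-> fadj x y.
  rewrite /f /= !enum_rankK /= eqxx /= !ffunE /= !valK (fadj_sym y x) andbb.
  by split=> [/orP [/eqP [] /val_inj ->|//]|->]; rewrite ?fadj_refl ?orbT.
by exists (@Emb (coh_of_fin Y) (coh_of_fin (universal_coh d)) f fi fc).
Qed.

Lemma nform_code : finite_functor F ->
  exists (m : nat) (code : nform F -> nat),
    (forall a, code a < m) /\ forall a b, code a = code b -> nf_iso a b.
Proof.
move=> [Ffin [d Fd]]; pose U : 'I_n -> fincoh := fun=> universal_coh d.
have Y_d (a : nform F) i : fcard (nf_sp a i) <= d.
  by apply: leq_trans (Fd a); rewrite (bigD1 i) //= leq_addr.
have e (a : nform F) : hom (coh_of_fins (nf_sp a)) (coh_of_fins U).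
  by move=> i; apply: (projT1 (cid (universal_emb (Y_d a i)))).
have /finite_setP [m /card_set_bijP [f [fm fi _]]] :
    finite_set [set: web (F (coh_of_fins U))].
  by apply: Ffin => i; apply: (@finite_finset 'I_(fcard (universal_coh d))).
exists m, (fun a => f ((farr F (e a) : emb _ _) (nf_pt a))); split.
  by move=> a; apply: (fm _ I).
move=> a b /fi E; have {}E := E (mem_set I) (mem_set I).
by have [t [ti _ Et]] := nform_unique E; exists t.
Qed.

(** The code depends on an embedding chosen separately for each normal form, so it need not be
    constant on an isomorphism class. A class is therefore represented by a member whose code is
    least in it. *)
Lemma nform_representatives : finite_functor F ->
  exists (p : nat) (f : 'I_p -> nform F),
    (forall j l, nf_iso (f j) (f l) -> j = l) /\ forall a, exists j, nf_iso a (f j).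
Proof.
move=> /nform_code [m [code [cm ci]]].
pose least k := exists a, code a = k /\ forall b, nf_iso a b -> k <= code b.
pose ks := [seq k <- iota 0 m | `[< least k >]].
have ksP (j : 'I_(size ks)) : least (nth 0 ks j).
  by have := mem_nth 0 (ltn_ord j); rewrite mem_filter => /andP [/asboolP].
exists (size ks), (fun j => sval (cid (ksP j))); split=> [j l|a].
  case: cid => a [/= ca la]; case: cid => b [/= cb lb] ab; apply: val_inj => /=.
  have uk : uniq ks by rewrite filter_uniq // iota_uniq.
  apply/eqP; rewrite -(nth_uniq 0 _ _ uk) //; apply/eqP.
  apply/eqP; rewrite eqn_leq -{2}ca -{1}cb la //= lb //; exact: nf_iso_sym.
have ex : exists k, `[< exists b, nf_iso a b /\ code b = k >].
  by exists (code a); apply/asboolP; exists a; split=> //; apply: nf_iso_refl.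
case: (ex_minnP ex) => k /asboolP [b [ab cb]] kmin.
have lk : least k.
  exists b; split=> // c bc; apply: kmin; apply/asboolP; exists c; split=> //.
  exact: nf_iso_trans ab bc.
have kk : k \in ks.
  by rewrite mem_filter mem_iota /= -{2}cb cm andbT; apply/asboolP.
move: (kk); rewrite -index_mem => ik; exists (Ordinal ik).
apply: nf_iso_trans ab _; apply: ci; case: cid => c [/= -> _].
by rewrite nth_index // cb.
Qed.
End NormalForms.

(** * Lexicographic minima and patterns *)

Definition lex_le (u v : seq nat) : bool := Order.le (u : seqlexi nat) (v : seqlexi nat).

Lemma lex_le_anti u v : lex_le u v -> lex_le v u -> u = v.
Proof. by move=> uv vu; apply: (@Order.POrderTheory.le_anti _ (seqlexi nat)); apply/andP. Qed.

Lemma lex_le_agree (T : Type) (l : seq T) (f g f' g' : T -> nat) :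
  (forall x, (f x <= g x) = (f' x <= g' x)) ->
  (forall x, (g x <= f x) = (g' x <= f' x)) ->
  lex_le (map f l) (map g l) = lex_le (map f' l) (map g' l).
Proof.
move=> fg gf; elim: l => //= x l; rewrite /lex_le => IH.
by rewrite !Order.SeqLexiOrder.Exports.lexi_cons !leEnat fg gf IH.
Qed.

(** The lexicographic order on lists of all lengths is not well founded, hence the confinement of
    [P] to a finite list. *)
Lemma lex_min (P : seq nat -> Prop) (l : seq (seq nat)) :
  (exists u, P u) -> (forall u, P u -> u \in l) ->
  exists u, P u /\ forall v, P v -> lex_le u v.
Proof.
elim: l P => [|x l IH] P [u Pu] Pl; first by have := Pl _ Pu.
have [[v [Pv vx]]|nv] := pselect (exists v, P v /\ v <> x); last first.
  have e v : P v -> v = x by move=> Pv; apply: contrapT => ?; apply: nv; exists v.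
  by exists u; split=> // v /e ->; rewrite (e _ Pu) /lex_le Order.POrderTheory.lexx.
have [|t [/= Pt tx]|t [[Pt tx] tmin]] := IH (fun v => P v /\ v <> x).
- by exists v.
- by have := Pl _ Pt; rewrite in_cons => /orP [/eqP|].
have [[Px xt]|nx] := pselect (P x /\ lex_le x t).
  exists x; split=> // y Py; have [->|yx] := eqVneq y x.
    by rewrite /lex_le Order.POrderTheory.lexx.
  apply: (@Order.POrderTheory.le_trans _ (seqlexi nat) t) => //.
  by apply: tmin; split=> //; apply/eqP.
exists t; split=> // y Py; have [yx|yx] := eqVneq y x; last first.
  by apply: tmin; split=> //; apply/eqP.
rewrite yx in Py *; have /orP [//|xt] := @Order.TotalTheory.le_total _ (seqlexi nat) t x.
by case: nx.
Qed.

Lemma map_pmap (T U V : Type) (f : T -> option U) (g : T -> V) (h : U -> V) l :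
  (forall x y, f x = Some y -> g x = h y) ->
  map h (pmap f l) = map g (filter (fun x => isSome (f x)) l).
Proof.
by move=> fgh; elim: l => //= x l IH; case E: (f x) => [y|] //=; rewrite (fgh x y E) IH.
Qed.

Lemma pattern_eqP adj adj' ss u u' :
  pattern adj ss u = pattern adj' ss u' <->
  forall k l, k < size ss -> l < size ss -> nth 0 ss k = nth 0 ss l ->
    (nth 0 u k <= nth 0 u l) = (nth 0 u' k <= nth 0 u' l) /\
    adj (nth 0 ss k) (nth 0 u k) (nth 0 u l) =
    adj' (nth 0 ss k) (nth 0 u' k) (nth 0 u' l).
Proof.
rewrite /pattern /answers; split=> [/eq_in_map H k l ks ls /eqP kl|H].
  have /H /= [-> ->] // : (k, l) \in queries ss by rewrite mem_queries ks ls.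
apply/eq_in_map => -[k l]; rewrite mem_queries => /and3P [ks ls /eqP kl] /=.
by have [-> ->] := H k l ks ls kl.
Qed.

Section Zigzag.
Variables (n : nat) (F : normal_functor n) (Y1 Y2 X X' : CohI^n).
Variables (e1 : hom Y1 X) (e2 : hom Y2 X) (e1' : hom Y1 X') (e2' : hom Y2 X').
Hypothesis same_eq : forall i a b,
  (e1 i : emb _ _) a = (e2 i : emb _ _) b <-> (e1' i : emb _ _) a = (e2' i : emb _ _) b.
Hypothesis same_coh : forall i a b,
  cohr ((e1 i : emb _ _) a) ((e2 i : emb _ _) b) <->
  cohr ((e1' i : emb _ _) a) ((e2' i : emb _ _) b).

Let in_union i (p : X i * X' i) : Prop :=
  (exists a, p = ((e1 i : emb _ _) a, (e1' i : emb _ _) a)) \/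
  (exists b, p = ((e2 i : emb _ _) b, (e2' i : emb _ _) b)).

(** With [union_coh], this says that the union of the two graphs is the graph of an isomorphism
    between subspaces of [X i] and [X' i]. *)
Let union_eq i (p q : X i * X' i) :
  in_union p -> in_union q -> (p.1 = q.1 <-> p.2 = q.2).
Proof.
move=> [] [a ->] [] [b ->] /=.
- by split=> /(@emb_inj _ _ (_ i : emb _ _)) ->.
- exact: same_eq.
- by split=> /esym /same_eq.
- by split=> /(@emb_inj _ _ (_ i : emb _ _)) ->.
Qed.

Let union_coh i (p q : X i * X' i) :
  in_union p -> in_union q -> (cohr p.1 q.1 <-> cohr p.2 q.2).
Proof.
move=> [] [a ->] [] [b ->] /=.
- by rewrite !emb_coh.
- exact: same_coh.
- by split=> /cohr_sym /same_coh /cohr_sym.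
- by rewrite !emb_coh.
Qed.

Let W : CohI^n := fun i =>
  @Coh {p : X i * X' i | in_union p} (fun p q => cohr (sval p).1 (sval q).1)
    (fun p => cohr_refl _) (fun p q => @cohr_sym _ _ _).

Let pr1 : hom W X.
Proof.
move=> i; apply: (@Emb (W i) (X i) (fun p => (sval p).1)) => // -[[x x'] p] [[y y'] q] /= E.
by apply: eq_exist; have := (union_eq p q).1 E => /= <-; rewrite E.
Defined.

Let pr2 : hom W X'.
Proof.
move=> i; apply: (@Emb (W i) (X' i) (fun p => (sval p).2)).
  move=> [[x x'] p] [[y y'] q] /= E.
  by apply: eq_exist; have := (union_eq p q).2 E => /= <-; rewrite E.
by move=> [p Wp] [q Wq] /=; rewrite -(union_coh Wp Wq).
Defined.

Let w1 : hom Y1 W.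
Proof.
move=> i; apply: (@Emb (Y1 i) (W i) (fun a => exist _ (_, _) (or_introl (ex_intro _ a erefl)))).
  by move=> a b /(congr1 sval) [] /(@emb_inj _ _ (e1 i : emb _ _)).
by move=> a b /=; rewrite emb_coh.
Defined.

Let w2 : hom Y2 W.
Proof.
move=> i; apply: (@Emb (Y2 i) (W i) (fun b => exist _ (_, _) (or_intror (ex_intro _ b erefl)))).
  by move=> a b /(congr1 sval) [] /(@emb_inj _ _ (e2 i : emb _ _)).
by move=> a b /=; rewrite emb_coh.
Defined.

(* Both pairs of embeddings factor through the span [X <- W -> X'] formed by
   the union of their graphs, and embeddings reflect coherence. *)
Lemma cohr_farr_agree (y1 : web (F Y1)) (y2 : web (F Y2)) :
  cohr ((farr F e1 : emb _ _) y1) ((farr F e2 : emb _ _) y2) <->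
  cohr ((farr F e1' : emb _ _) y1) ((farr F e2' : emb _ _) y2).
Proof.
have -> : e1 = cmp pr1 w1 by apply: power_ext.
have -> : e2 = cmp pr1 w2 by apply: power_ext.
have -> : e1' = cmp pr2 w1 by apply: power_ext.
have -> : e2' = cmp pr2 w2 by apply: power_ext.
by rewrite !farr_cmp !emb_coh.
Qed.
End Zigzag.

(** * Codes of points *)

Section Codes.
Variables (n : nat) (F : normal_functor n) (p : nat) (nf : 'I_p -> nform F).
Hypothesis nf_inj : forall j l, nf_iso (nf j) (nf l) -> j = l.
Hypothesis nf_complete : forall a, exists j, nf_iso a (nf j).

Let Y j := nf_sp (nf j).

Let slot j := {i : 'I_n & 'I_(fcard (Y j i))}.

(** The order is that of [encode_embedding], so that printing [values] from left to right prints the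
    embedding. *)
Definition slots j : seq (slot j) :=
  flatten [seq [seq Tagged (fun i => 'I_(fcard (Y j i))) a
               | a <- enum 'I_(fcard (Y j i))] | i <- enum 'I_n].

Lemma mem_slots j (s : slot j) : s \in slots j.
Proof.
apply/flatten_mapP; exists (tag s); first by rewrite mem_enum.
by apply/mapP; exists (tagged s); [rewrite mem_enum|case: s].
Qed.

Lemma slots_uniq j : uniq (slots j).
Proof.
apply: allpairs_uniq_dep => [|i _|[i a] [i' a'] _ _ //]; exact: enum_uniq.
Qed.

Definition sorts (j : nat) : seq nat :=
  if insub j is Some j' then [seq val (tag s) | s <- slots (j' : 'I_p)] else [::].

Lemma sortsE (j : 'I_p) : sorts j = [seq val (tag s) | s <- slots j].
Proof. by rewrite /sorts valK. Qed.

Definition slot_idx (j : 'I_p) (s : slot j) : nat := index s (slots j).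
Arguments slot_idx : clear implicits.

Lemma slot_idx_lt (j : 'I_p) s : slot_idx j s < size (sorts j).
Proof. by rewrite sortsE size_map index_mem mem_slots. Qed.

Lemma nth_sorts (j : 'I_p) (s : slot j) : nth 0 (sorts j) (slot_idx j s) = tag s.
Proof.
by rewrite sortsE (nth_map s) ?nth_index ?mem_slots // index_mem mem_slots.
Qed.

Section Values.
Variables (X : 'I_n -> fincoh) (j : 'I_p).
Implicit Type e : hom (coh_of_fins (Y j)) (coh_of_fins X).

Definition slot_val e (s : slot j) : nat :=
  (e (tag s) : emb _ _) (tagged s) : 'I_(fcard (X (tag s))).

Definition values e : seq nat := [seq slot_val e s | s <- slots j].

Lemma nth_values e s : nth 0 (values e) (slot_idx j s) = slot_val e s.
Proof. by rewrite (nth_map s) ?nth_index ?index_mem ?mem_slots. Qed.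

Lemma size_values e : size (values e) = size (sorts j).
Proof. by rewrite sortsE !size_map. Qed.

Lemma values_inj e e' : values e = values e' -> e = e'.
Proof.
move=> E; apply: power_ext => i a; apply: val_inj.
have := nth_values e (Tagged (fun i => 'I_(fcard (Y j i))) a).
by rewrite E nth_values.
Qed.

Lemma values_in_range e : in_range (gcard X) (values e) (sorts j).
Proof.
rewrite sortsE /values /in_range; elim: (slots j) => //= s l ->.
by rewrite andbT gcardE /slot_val ltn_ord.
Qed.

Lemma encode_values e :
  encode_embedding e = flatten [seq encode_nat x | x <- values e].
Proof.
rewrite /encode_embedding /values /slots; elim: (enum 'I_n) => //= i l ->.
by rewrite !map_cat flatten_cat -!map_comp.
Qed.

(** Such a [t] is automatically an automorphism, by [nf_min]. *)
Definition stabilizer (t : hom (coh_of_fins (Y j)) (coh_of_fins (Y j))) : Prop :=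
  (farr F t : emb _ _) (nf_pt (nf j)) = nf_pt (nf j).

(* One embedding in each orbit under the automorphisms of the normal form. *)
Definition canonical e : Prop :=
  forall t, stabilizer t -> lex_le (values e) (values (cmp e t)).

Definition point e : web (F (coh_of_fins X)) := (farr F e : emb _ _) (nf_pt (nf j)).

(** By [nform_unique] each embedding is the other composed with an element of the stabilizer, so
    each tuple of values is below the other. *)
Lemma canonical_inj e e' : canonical e -> canonical e' -> point e = point e' -> e = e'.
Proof.
move=> ce ce' E; apply: values_inj; apply: lex_le_anti.
  have [t [_ -> tE]] := nform_unique (esym E); exact: ce.
have [t [_ -> tE]] := nform_unique E; exact: ce'.
Qed.

Lemma canonical_exists e : exists e', canonical e' /\ point e' = point e.
Proof.
pose P u := exists e', values e' = u /\ point e' = point e.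
have [|u [e' [<- E]]|u [[e' [<- E]] umin]] :=
  @lex_min P (tuples (gcard X) (sorts j)).
- by exists (values e), e.
- by rewrite mem_tuples; apply: values_in_range.
exists e'; split=> // t tE; apply: umin; exists (cmp e' t); split=> //.
by rewrite -E /point farr_cmp tE.
Qed.
End Values.

Lemma slot_val_cohr (X : 'I_n -> fincoh) (j l : 'I_p)
    (e : hom (coh_of_fins (Y j)) (coh_of_fins X))
    (e' : hom (coh_of_fins (Y l)) (coh_of_fins X)) (i : 'I_n) a b :
  gadj X i (slot_val e (Tagged (fun i => 'I_(fcard (Y j i))) a))
    (slot_val e' (Tagged (fun i => 'I_(fcard (Y l i))) b)) =
  fadj ((e i : emb _ _) a : 'I_(fcard (X i))) ((e' i : emb _ _) b).
Proof. exact: gadjE. Qed.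

(** The order answers make [u] injective on each sort and the adjacency answers make it an
    embedding. Canonicity carries over because composing with [t] only moves entries within their
    sort, so the comparisons it involves are among the queries. *)
Lemma transfer (X X' : 'I_n -> fincoh) (j : 'I_p)
    (e : hom (coh_of_fins (Y j)) (coh_of_fins X)) u :
  canonical e -> in_range (gcard X') u (sorts j) ->
  pattern (gadj X) (sorts j) (values e) = pattern (gadj X') (sorts j) u ->
  exists e' : hom (coh_of_fins (Y j)) (coh_of_fins X'),
    values e' = u /\ canonical e'.
Proof.
move=> ce ur /pattern_eqP H.
have agree (s t : slot j) : tag s = tag t ->
    (slot_val e s <= slot_val e t) =
      (nth 0 u (slot_idx j s) <= nth 0 u (slot_idx j t)) /\
    gadj X (tag s) (slot_val e s) (slot_val e t) =
      gadj X' (tag s) (nth 0 u (slot_idx j s)) (nth 0 u (slot_idx j t)).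
  move=> st; have := H _ _ (slot_idx_lt s) (slot_idx_lt t).
  by rewrite !nth_sorts !nth_values st => /(_ erefl).
pose T i (a : 'I_(fcard (Y j i))) : slot j := Tagged (fun i => 'I_(fcard (Y j i))) a.
have lt i a : nth 0 u (slot_idx j (T i a)) < fcard (X' i).
  by have := in_range_nth ur (slot_idx_lt (T i a)); rewrite nth_sorts gcardE.
pose f i a : 'I_(fcard (X' i)) := Ordinal (lt i a).
have fi i : injective (f i).
  move=> a b /(congr1 val) /= ab; apply: (@emb_inj _ _ (e i : emb _ _)).
  have [l1 _] := agree (T i a) (T i b) erefl.
  have [l2 _] := agree (T i b) (T i a) erefl.
  by apply: val_inj; apply/eqP; rewrite eqn_leq [X in X && _]l1 [X in _ && X]l2 ab leqnn.
have fc i a b : @fadj (X' i) (f i a) (f i b) <-> @fadj (Y j i) a b.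
  have [_ ad] := agree (T i a) (T i b) erefl.
  rewrite -(gadjE (X := X')) /= -ad slot_val_cohr.
  exact: (emb_coh (e i : emb _ _)).
pose e' : hom (coh_of_fins (Y j)) (coh_of_fins X') :=
  fun i => @Emb (coh_of_fin (Y j i)) (coh_of_fin (X' i)) (f i) (@fi i) (@fc i).
have e'E s : slot_val e' s = nth 0 u (slot_idx j s) by case: s.
have vE : values e' = u.
  apply: (@eq_from_nth _ 0); first by rewrite size_values (in_range_size ur).
  move=> k; rewrite size_map => ks.
  have s0 : slot j by move: ks; case: (slots j).
  by rewrite (nth_map s0) // e'E /slot_idx index_uniq // slots_uniq.
exists e'; split=> // t tE; move: (ce t tE); rewrite /values.
suff -> : lex_le (map (slot_val e) (slots j)) (map (slot_val (cmp e t)) (slots j)) =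
    lex_le (map (slot_val e') (slots j)) (map (slot_val (cmp e' t)) (slots j)) by [].
(* The action of [t] on slots; [tag] is preserved, which is what [agree] requires. *)
pose ts (s : slot j) := T (tag s) ((t (tag s) : emb _ _) (tagged s)).
have cE (Z : 'I_n -> fincoh) (f' : hom (coh_of_fins (Y j)) (coh_of_fins Z)) s :
  slot_val (cmp f' t) s = slot_val f' (ts s) by [].
apply: lex_le_agree => s; rewrite !cE !e'E.
  exact: (agree s (ts s) erefl).1.
exact: (agree (ts s) s erefl).1.
Qed.

(** The joint pattern supplies the hypotheses of [cohr_farr_agree]: [<=] in both directions tells
    which vertices the two images share, and adjacency tells which are coherent. *)
Lemma transfer_cohr (X X' : 'I_n -> fincoh) (j l : 'I_p)
    (e1 : hom (coh_of_fins (Y j)) (coh_of_fins X))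
    (e2 : hom (coh_of_fins (Y l)) (coh_of_fins X))
    (e1' : hom (coh_of_fins (Y j)) (coh_of_fins X'))
    (e2' : hom (coh_of_fins (Y l)) (coh_of_fins X')) :
  pattern (gadj X) (sorts j ++ sorts l) (values e1 ++ values e2) =
  pattern (gadj X') (sorts j ++ sorts l) (values e1' ++ values e2') ->
  cohr (point e1) (point e2) <-> cohr (point e1') (point e2').
Proof.
move=> /pattern_eqP H.
have agree (s : slot j) (t : slot l) : tag s = tag t ->
    [/\ (slot_val e1 s <= slot_val e2 t) = (slot_val e1' s <= slot_val e2' t),
        (slot_val e2 t <= slot_val e1 s) = (slot_val e2' t <= slot_val e1' s) &
        gadj X (tag s) (slot_val e1 s) (slot_val e2 t) =
        gadj X' (tag s) (slot_val e1' s) (slot_val e2' t)].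
  move=> st; pose k := slot_idx j s; pose m := size (sorts j) + slot_idx l t.
  have ks : k < size (sorts j ++ sorts l).
    by rewrite size_cat ltn_addr // slot_idx_lt.
  have ms : m < size (sorts j ++ sorts l) by rewrite size_cat ltn_add2l slot_idx_lt.
  have nk : nth 0 (sorts j ++ sorts l) k = tag s.
    by rewrite nth_cat slot_idx_lt nth_sorts.
  have nm : nth 0 (sorts j ++ sorts l) m = tag s.
    by rewrite nth_cat ltnNge leq_addr /= addKn nth_sorts st.
  have vk (Z : 'I_n -> fincoh) (f1 : hom (coh_of_fins (Y j)) (coh_of_fins Z))
      (f2 : hom (coh_of_fins (Y l)) (coh_of_fins Z)) :
      nth 0 (values f1 ++ values f2) k = slot_val f1 s.
    by rewrite nth_cat size_values slot_idx_lt nth_values.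
  have vm (Z : 'I_n -> fincoh) (f1 : hom (coh_of_fins (Y j)) (coh_of_fins Z))
      (f2 : hom (coh_of_fins (Y l)) (coh_of_fins Z)) :
      nth 0 (values f1 ++ values f2) m = slot_val f2 t.
    by rewrite nth_cat size_values ltnNge leq_addr /= addKn nth_values.
  have [l1 a1] := H k m ks ms (etrans nk (esym nm)).
  have [l2 _] := H m k ms ks (etrans nm (esym nk)).
  by rewrite !vk !vm ?nk in l1 l2 a1.
apply: cohr_farr_agree => i a b.
  have [l1 l2 _] := agree (Tagged (fun i => 'I_(fcard (Y j i))) a)
    (Tagged (fun i => 'I_(fcard (Y l i))) b) erefl.
  by split=> E; apply: val_inj; apply/eqP; rewrite eqn_leq;
    [rewrite -[X in X && _]l1 -[X in _ && X]l2|rewrite [X in X && _]l1 [X in _ && X]l2];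
    rewrite /slot_val /= E leqnn.
have [_ _ ad] := agree (Tagged (fun i => 'I_(fcard (Y j i))) a)
  (Tagged (fun i => 'I_(fcard (Y l i))) b) erefl.
by rewrite /= !slot_val_cohr in ad; rewrite /= ad.
Qed.

(** A joint pattern contains the pattern of its second tuple; [coherence_bitE] needs this to
    recognize second tuples that code no point. *)
Lemma pattern_catr adj adj' ss ts u u' v v' :
  size u = size ss -> size u' = size ss ->
  pattern adj (ss ++ ts) (u ++ v) = pattern adj' (ss ++ ts) (u' ++ v') ->
  pattern adj ts v = pattern adj' ts v'.
Proof.
move=> us us' /pattern_eqP H; apply/pattern_eqP => k l ks ls kl.
have := H (size ss + k) (size ss + l); rewrite size_cat !ltn_add2l => /(_ ks ls).
by rewrite !nth_cat us us' !ltnNge !leq_addr /= !addKn => /(_ kl).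
Qed.

Definition code (X : 'I_n -> fincoh) : Type :=
  {j : 'I_p & hom (coh_of_fins (nf_sp (nf j))) (coh_of_fins X)}.

Implicit Types X : 'I_n -> fincoh.

Definition key X (c : code X) : nat * seq nat := (val (projT1 c), values (projT2 c)).

Lemma key_inj X : injective (@key X).
Proof.
move=> [j e] [j' e'] [] /= /val_inj jj; case: _ / jj e' => e'.
by move/values_inj ->.
Qed.

Definition canonical_code X (c : code X) : Prop := canonical (projT2 c).

Definition lookup X (q : nat * seq nat) : option (code X) :=
  match pselect (exists c : code X, key c = q /\ canonical_code c) with
  | left H => Some (sval (cid H))
  | right _ => None
  end.

Lemma lookupP X q (c : code X) : lookup X q = Some c -> key c = q /\ canonical_code c.
Proof. by rewrite /lookup; case: pselect => // H [<-]; case: cid. Qed.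

Lemma lookup_key X (c : code X) : canonical_code c -> lookup X (key c) = Some c.
Proof.
move=> cc; rewrite /lookup; case: pselect => [H|[]]; last by exists c.
by case: cid => c' [/= /key_inj -> _].
Qed.

Let js := iota 0 p.

Lemma sorts_ltn j : j \in js -> all (fun i => i < n) (sorts j).
Proof.
rewrite mem_iota /= => jp; rewrite -[j]/(val (Ordinal jp)) sortsE all_map.
by apply/allP => s _ /=.
Qed.

Lemma candidate_in_range X q :
  q \in candidates (gcard X) js sorts -> in_range (gcard X) q.2 (sorts q.1).
Proof. by case/allpairsPdep => [j [u [_ us ->]]]; rewrite -mem_tuples. Qed.

Lemma candidate_key X (c : code X) : key c \in candidates (gcard X) js sorts.
Proof.
apply/allpairsPdep; exists (val (projT1 c)), (values (projT2 c)); split=> //.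
  by rewrite mem_iota /=.
by rewrite mem_tuples; apply: values_in_range.
Qed.

(** The filtering keeps the order of the candidates, which is the order in which the program loops
    visit them. *)
Definition codes X : seq (code X) := pmap (lookup X) (candidates (gcard X) js sorts).

Lemma map_codes X (V : Type) (g : nat * seq nat -> V) (h : code X -> V) :
  (forall c, canonical_code c -> g (key c) = h c) ->
  map h (codes X) =
  map g (filter (fun q => isSome (lookup X q)) (candidates (gcard X) js sorts)).
Proof.
by move=> gh; apply: map_pmap => q c /lookupP [<- cc]; apply: gh.
Qed.

Lemma codes_uniq X : uniq (map (@key X) (codes X)).
Proof.
rewrite (@map_codes X _ id) // map_id filter_uniq //.
apply: allpairs_uniq_dep; first exact: iota_uniq.
  by move=> *; apply: tuples_uniq.
by move=> [j u] [j' u'] _ _ [] /= -> ->.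
Qed.

Lemma codes_complete X (c : code X) :
  canonical_code c -> exists k : 'I_(size (codes X)), tnth (in_tuple (codes X)) k = c.
Proof.
move=> cc; have : key c \in map (@key X) (codes X).
  by rewrite (@map_codes X _ id) // map_id mem_filter candidate_key lookup_key.
rewrite -index_mem size_map => lt; exists (Ordinal lt); apply: key_inj.
rewrite (tnth_nth c) /= -(nth_map c (key c)) // nth_index //.
by rewrite -index_mem size_map.
Qed.

Lemma codes_canonical X (k : 'I_(size (codes X))) :
  canonical_code (tnth (in_tuple (codes X)) k).
Proof.
set c := tnth _ _; have [q _ qc] : exists2 q, True & lookup X q = Some c.
  have : onth (codes X) k = Some c by rewrite -(tnth_onth c (in_tuple (codes X))).
  rewrite /codes; elim: (candidates _ _ _) (k : nat) => [|q l IH] i /=; first by case: i.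
  case E: (lookup X q) => [c'|] /=; last exact: IH.
  by case: i => [[<-]|i /IH //]; exists q.
by have [] := lookupP qc.
Qed.

(** The input is quantified away, so this is a constant that can be built into a program; [goodE]
    shows by [transfer] that one occurrence of the pattern settles all of them. *)
Definition good (j : nat) (a : seq (bool * bool)) : bool :=
  `[< exists (X : 'I_n -> fincoh) (c : code X), [/\ canonical_code c,
      (key c).1 = j & pattern (gadj X) (sorts j) (key c).2 = a] >].

Lemma goodE X q : q \in candidates (gcard X) js sorts ->
  good q.1 (pattern (gadj X) (sorts q.1) q.2) = isSome (lookup X q).
Proof.
move=> qX; apply/asboolP/idP => [[X' [[j e] [ce /= jq E]]]|]; last first.
  by case L: lookup => [c|] // _; have [<- cc] := lookupP L; exists X, c.
have qr := candidate_in_range qX; rewrite -jq in qr E.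
have [e' [ve' ce']] := transfer ce qr E.
have -> : q = key (existT _ j e' : code X).
  by rewrite (surjective_pairing q) -jq -ve'.
by rewrite lookup_key.
Qed.

Lemma map_codes_selected X (V : Type) (g : nat * seq nat -> V) (h : code X -> V) :
  (forall c, canonical_code c -> g (key c) = h c) ->
  map h (codes X) = map g (gselected js sorts good X).
Proof.
move=> gh; rewrite (map_codes gh); congr map; apply: eq_in_filter => q qX.
by rewrite goodE.
Qed.

Definition code_point X (c : code X) : web (F (coh_of_fins X)) := point (projT2 c).

Definition code_cohr X (c c' : code X) : Prop := cohr (code_point c) (code_point c').

Definition pair_pattern j l a X (c c' : code X) : Prop :=
  [/\ canonical_code c, canonical_code c', (key c).1 = j, (key c').1 = l &
    pattern (gadj X) (sorts j ++ sorts l) ((key c).2 ++ (key c').2) = a].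

(** The empty output marks patterns of no pair of canonical codes. Otherwise one coherent pair with
    the pattern is enough for the bit to be true, since by [transfer_cohr] all such pairs agree. *)
Definition coherence_bit (j l : nat) (a : seq (bool * bool)) : seq symbol :=
  if pselect (exists (X : 'I_n -> fincoh) (c c' : code X), pair_pattern j l a c c') then
    [:: Some `[< exists (X : 'I_n -> fincoh) (c c' : code X),
                 pair_pattern j l a c c' /\ code_cohr c c' >]]
  else [::].

Lemma coherence_bitE X (c : code X) q :
  canonical_code c -> q \in candidates (gcard X) js sorts ->
  coherence_bit (key c).1 q.1
    (pattern (gadj X) (sorts (key c).1 ++ sorts q.1) ((key c).2 ++ q.2)) =
  if lookup X q is Some c' then [:: Some `[< code_cohr c c' >]] else [::].
Proof.
move=> cc qX; rewrite /coherence_bit; case L: lookup => [c'|]; last first.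
  case: pselect => //= -[X' [c1 [c2 [_ cc2 E1 E2 E]]]].
  (* If the joint pattern came from a canonical pair, its second half would make [q] good, although
     [lookup] fails on it. *)
  have := goodE qX; rewrite L => /negP; case; apply/asboolP.
  exists X', c2; split=> //; apply: pattern_catr E.
    by rewrite -E1 size_values.
  by rewrite size_values.
have [<- cc'] := lookupP L; case: pselect => /= [_|[]]; last by exists X, c, c'.
congr [:: Some _]; apply: asbool_equiv_eq; split=> [|H]; last by exists X, c, c'.
move=> [X' [c1 [c2 [[_ _ E1 E2 E]]]]].
case: c c' c1 c2 {cc cc' L} E1 E2 E => [j e] [l f] [j1 e1] [l1 f1] /=.
move=> /val_inj jj /val_inj ll; case: _ / jj e => e; case: _ / ll f => f E.
by apply: (transfer_cohr E).1.
Qed.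

Lemma map_tnth_enum_codes X (V : Type) (h : code X -> V) :
  [seq h (tnth (in_tuple (codes X)) k) | k <- enum 'I_(size (codes X))] = map h (codes X).
Proof. by rewrite (map_comp h) map_tnth_enum. Qed.

(** Equal points have isomorphic normal forms, hence the same index, and canonicity then fixes the
    embedding. Conversely, the normal form of a point is transported to its representative and the
    embedding replaced by the least one of its orbit. *)
Lemma code_point_bij X :
  bijective (fun k : 'I_(size (codes X)) => code_point (tnth (in_tuple (codes X)) k)).
Proof.
have inj : injective (fun k : 'I_(size (codes X)) => code_point (tnth (in_tuple (codes X)) k)).
  move=> k l /= E.
  suff kl : key (tnth (in_tuple (codes X)) k) = key (tnth (in_tuple (codes X)) l).
    have [d _] : exists d : code X, True by exists (tnth (in_tuple (codes X)) k).
    apply: ord_inj; apply/eqP; rewrite -(nth_uniq (key d) _ _ (codes_uniq X)) ?size_map //.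
    by rewrite !(tnth_nth d) /= in kl; rewrite !(nth_map d) //; apply/eqP.
  have := @codes_canonical X k; have := @codes_canonical X l; move: E.
  case: (tnth _ k) => [j e]; case: (tnth _ l) => [j' e'] E ce' ce.
  have [t [ti _ tE]] := nform_unique E.
  have jj : j = j' by apply: nf_inj; exists t.
  case: _ / jj e' E ce' {t ti tE} => e' E ce'.
  by have /= -> := canonical_inj ce ce' E.
have surj (x : web (F (coh_of_fins X))) :
    exists k : 'I_(size (codes X)), code_point (tnth (in_tuple (codes X)) k) = x.
  have [a [f <-]] := nform_exists x; have [j /nf_iso_sym [t [_ <-]]] := nf_complete a.
  rewrite -farr_cmp; have [e' [ce' eE]] := canonical_exists (cmp f t).
  have [k kE] := @codes_complete X (existT _ j e') ce'; exists k; rewrite kE; exact: eE.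
have [g gP] := choice surj; exists g => // k; apply: inj; exact: gP.
Qed.

Definition code_presentation : presentation F :=
  @Presentation n F p nf nf_inj (fun X => size (codes X))
    (fun X k => tnth (in_tuple (codes X)) k) code_point_bij.

Lemma encode_value_codes X : encode_value code_presentation X =
  rcons (flatten [seq rcons [seq Some `[< code_cohr c c' >] | c' <- codes X] None
                 | c <- codes X]) None ++
  flatten [seq encode_nat (key c).1 ++ flatten [seq encode_nat x | x <- (key c).2]
          | c <- codes X].
Proof.
rewrite /encode_value /encode_graph; congr (rcons (flatten _) None ++ flatten _).
  rewrite -map_tnth_enum_codes; apply: eq_map => k; congr rcons.
  by rewrite -map_tnth_enum_codes.
rewrite -map_tnth_enum_codes; apply: eq_map => k.
by rewrite /encode_point encode_values.
Qed.

Lemma logspace_value : logspace_computable (@encode_input n)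
  (fun X => encode_value code_presentation X).
Proof.
have := logspace_matrix_list good sorts_ltn coherence_bit.
congr logspace_computable; apply/funext => X; rewrite encode_value_codes; congr cat.
  congr rcons; congr flatten; apply/esym/map_codes_selected => c cc; congr rcons.
  (* Candidates without a code contribute nothing, so the concatenation over all candidates is
     exactly the row indexed by [codes X]. *)
  rewrite /codes; move: (@coherence_bitE X c) => /(_ _ cc).
  elim: (candidates _ _ _) => //= q l IH H; rewrite H ?mem_head // IH; last first.
    by move=> r rl; apply: H; rewrite in_cons rl orbT.
  by case: lookup.
by congr flatten; apply/esym/map_codes_selected.
Qed.

(** Membership depends on the index of the normal form only, not on the embedding: by
    [nform_unique], any other presentation of the point uses an isomorphic normal form. So
    [logspace_subset] needs just one constant bit per index. *)
Lemma family_code_point (c : set (Tr F)) X (d : code X) :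
  family c (coh_of_fins X) (code_point d) <->
  exists C : Tr F, c C /\ sval C (nf (projT1 d)).
Proof.
split=> [[C [cC [a [aC [i E]]]]]|[C [cC dC]]].
  exists C; split=> //; have [a' [aa' CE]] := nf_class_surj C.
  have [t [ti _ tE]] := nform_unique E.
  move: aC; rewrite CE /= => a'a; apply: nf_iso_trans a'a _; apply: nf_iso_sym.
  by exists t.
by exists C; split=> //; exists (nf (projT1 d)); split=> //; exists (projT2 d).
Qed.

Lemma logspace_subset (c : set (Tr F)) : logspace_computable (@encode_input n)
  (fun X => encode_subset code_presentation (family c (coh_of_fins X))).
Proof.
pose B (j : nat) : seq symbol := [:: Some `[< exists l : 'I_p, val l = j /\
  exists C : Tr F, c C /\ sval C (nf l) >]].
have := logspace_mark good sorts_ltn B.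
congr logspace_computable; apply/funext => X.
pose b (d : code X) : symbol := Some `[< family c (coh_of_fins X) (code_point d) >].
transitivity (map b (codes X)); last by rewrite -map_tnth_enum_codes.
have -> : map b (codes X) = flatten [seq [:: b d] | d <- codes X].
  by elim: (codes X) => //= d l ->.
congr flatten; apply/esym/map_codes_selected => d cd; congr [:: Some _].
apply: asbool_equiv_eq; rewrite family_code_point; split=> [[l [/val_inj -> //]]|H].
by exists (projT1 d).
Qed.
End Codes.

Theorem theorem32 (n : nat) (F : normal_functor n)
    (F_definable : mall2_definable F) (F_finite : finite_functor F) :
  exists P : presentation F,
    logspace_computable (@encode_input n) (fun X => encode_value P X) /\
    forall c : set (Tr F), clique c ->
      logspace_computable (@encode_input n)
        (fun X => encode_subset P (family c (coh_of_fins X))).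
Proof.
have [p [nf [nf_inj nf_complete]]] := nform_representatives F_finite.
exists (code_presentation nf_inj nf_complete); split; first exact: logspace_value.
by move=> c _; apply: logspace_subset.
Qed.
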